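(* Let $\gamma>0$, $\varphi_0(r)=\left(1+\log\frac{1}{1-r}\right)^{-\gamma}$, $r\in[0,1)$, let $L\ge1$ be an integer, $I_j=[2\pi(j-1)/L,2\pi j/L)$, and $\tilde\chi_j(re^{i\theta})=\mathbf{1}_{I_j}(\theta)\varphi_0(r)$ for $j=1,\dots,L$. Then for all $j\neq k$, $j,k\in\{1,\dots,L\}$, $$T_{\tilde\chi_k}^*T_{\tilde\chi_j}\in\Sigma^0_{2\gamma}\quad\text{and}\quad T_{\tilde\chi_k}T_{\tilde\chi_j}^*\in\Sigma^0_{2\gamma}.$$
   Context: $L^2_a(\mathbb{D})$ is the Bergman space (analytic functions in $L^2(\mathbb{D},dx\,dy/\pi)$), $P_+$ the orthogonal projection onto it, and $T_\varphi f=P_+(\varphi f)$ the Toeplitz operator with bounded symbol $\varphi$. For $\beta>0$, $\Sigma^0_\beta$ is the class of compact operators $A$ whose singular values satisfy $s_n(A)=o\big((\log(n+1))^{-\beta}\big)$ as $n\to\infty$. *)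

(* Defs.v *)
From HB Require Import structures.
From mathcomp Require Import all_boot all_order all_algebra.
From mathcomp Require Import complex.
From mathcomp Require Import all_classical all_reals all_analysis.
From Stdlib Require Import ClassicalEpsilon.
Set Implicit Arguments. Unset Strict Implicit. Unset Printing Implicit Defensive.
Import Order.TTheory GRing.Theory Num.Theory.
Import numFieldNormedType.Exports.
Local Open Scope classical_set_scope.
Local Open Scope ring_scope.

Section Bergman.
Variable R : realType.
Local Notation Re := (@complex.Re R).
Local Notation Im := (@complex.Im R).
Local Notation C := (R[i]).

Definition pt (p : R * R) : C := Complex p.1 p.2.
Definition cconj (z : C) : C := Complex (Re z) (- Im z).
Definition csq (z : C) : R := Re z ^+ 2 + Im z ^+ 2.
Definition cabs (z : C) : R := Num.sqrt (csq z).

Definition disc : set (R * R) := [set p | p.1 ^+ 2 + p.2 ^+ 2 < 1].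

Definition area := ((@lebesgue_measure R) \x (@lebesgue_measure R))%E.

Definition cint (h : C -> C) : C :=
  Complex (Rintegral area disc (fun p => Re (h (pt p))) / pi)
          (Rintegral area disc (fun p => Im (h (pt p))) / pi).

Definition L2 (f : C -> C) : Prop :=
  measurable_fun disc (fun p => Re (f (pt p))) /\
  measurable_fun disc (fun p => Im (f (pt p))) /\
  (\int[area]_(p in disc) (csq (f (pt p)))%:E < +oo)%E.

Definition analytic_disc (f : C -> C) : Prop :=
  exists a : nat -> C, forall p, disc p ->
    (fun N => Re (\sum_(n < N) a n * pt p ^+ n)) @ \oo --> Re (f (pt p)) /\
    (fun N => Im (\sum_(n < N) a n * pt p ^+ n)) @ \oo --> Im (f (pt p)).

Definition bergman (f : C -> C) : Prop := analytic_disc f /\ L2 f.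

Definition inner (f g : C -> C) : C := cint (fun z => f z * cconj (g z)).
Definition norm2 (f : C -> C) : R := Num.sqrt (Re (inner f f)).

Definition is_bergman_proj (u g : C -> C) : Prop :=
  bergman g /\ forall h, bergman h -> inner (u \- g) h = 0.

Definition Pplus (u : C -> C) : C -> C := epsilon (inhabits (fun _ => 0)) (is_bergman_proj u).

Definition operator := (C -> C) -> (C -> C).

Definition toeplitz (phi : C -> C) : operator := fun f => Pplus (phi \* f).

Definition adjoint (A : operator) : operator := fun g =>
  epsilon (inhabits (fun _ => 0))
    (fun h => bergman h /\ forall f, bergman f -> inner (A f) g = inner f h).

Definition comp_op (A B : operator) : operator := fun f => A (B f).

Definition rank_le (n : nat) (F : operator) : Prop :=
  exists u v : nat -> C -> C, (forall i, bergman (u i) /\ bergman (v i)) /\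
    forall f, bergman f -> forall z,
      F f z = \sum_(i < n) inner f (u i) * v i z.

Definition opnorm (A : operator) : \bar R :=
  ereal_sup [set (norm2 (A f))%:E | f in [set f | bergman f /\ norm2 f <= 1]].

(* n-th singular value (approximation number), n = 0, 1, ... :
   s_n(A) = inf { ||A - F|| : rank F <= n } *)
Definition sing_val (A : operator) (n : nat) : \bar R :=
  ereal_inf [set opnorm (fun f => A f \- F f) | F in rank_le n].

Definition Sigma0 (beta : R) (A : operator) : Prop :=
  forall eps : R, 0 < eps ->
    \forall n \near \oo,
      (sing_val A n <= (eps * powR (ln (n.+1%:R)) (- beta))%:E)%E.

Definition phi0 (gamma r : R) : R := powR (1 + ln ((1 - r)^-1)) (- gamma).

Definition arc (L j : nat) : set R :=
  [set t | 2 * pi * (j%:R - 1) / L%:R <= t /\ t < 2 * pi * j%:R / L%:R].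

Definition chi (gamma : R) (L j : nat) (z : C) : C :=
  if `[< cabs z < 1 /\ exists t, arc L j t /\
         Re z = cabs z * cos t /\ Im z = cabs z * sin t >]
  then Complex (phi0 gamma (cabs z)) 0 else 0.

End Bergman.

(* Main.v *)
(* Both operators agree, up to null functions, with [f |-> P (chi_k P (chi_j f))], where the
   Bergman projection [P] has kernel [kappa / (1 - conj z * w) ^ 2].  Put [eps = (n + 1) ^ -K] and
   let [chi^o] be the restriction of [chi] to [1 - |z| < eps].  The part
   [P (chi_k^o P (chi_j^o f))] has norm at most [phi0 (1 - eps) ^ 2 <= (K ln (n + 1)) ^ (- 2 gamma)].
   In the rest one of the two points keeps distance [eps] from the circle.  As the two sectors are
   separated by a line through 0, there [|1 - conj z * w|] dominates [eps] and the distances of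
   [z] and of [w] to the two points where the line meets the circle, so that
   [|1 - conj z * w| ^ -4] is at most [Omega z * Omega w] with
   [int Omega = O (ln (1 / eps) ^ 2)].  The rest is thus Hilbert--Schmidt with squared norm
   [O (ln (n + 1) ^ 4)], and subtracting a rank-[n] operator leaves a norm
   [O (ln (n + 1) ^ 2 / sqrt (n + 1))].  Finally [K] is arbitrary. *)
Require Import Defs.
From HB Require Import structures.
From mathcomp Require Import all_boot all_order all_algebra.
From mathcomp Require Import complex.
From mathcomp Require Import all_classical all_reals all_analysis.
From mathcomp Require Import measurable_realfun zify ring lra.
From Stdlib Require Import ClassicalEpsilon.
Set Implicit Arguments. Unset Strict Implicit. Unset Printing Implicit Defensive.
Import Order.TTheory GRing.Theory Num.Theory.
Import numFieldNormedType.Exports.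
Local Open Scope classical_set_scope.
Local Open Scope ring_scope.

(** * Coordinate arithmetic of complex numbers *)

Section ComplexNumbers.
Variable R : realType.
Local Notation C := R[i].
Local Notation Re := (@complex.Re R).
Local Notation Im := (@complex.Im R).
Implicit Types (x y z : C) (a : R).

(** [Pplus] and [adjoint] are [epsilon] choices, constrained only on the disc and through inner
    products, so what they return is used only up to [nsq] zero. All estimates are made on [proj],
    an integral against the kernel with values at points; [bergman_proj_unique] then transfers them
    to the chosen functions. That [proj] is a Bergman projection rests on completeness of the
    monomials: an analytic function in [L2] has to be the norm limit of its power series. This is
    deduced from smaller discs, on which the partial sums are bounded and the monomials stay
    orthogonal. The moments of these discs come from Green's formula on Cartesian slices, with the
    normalised area carried along as the constant [disc_mass]. The kernel is dominated by a product
    in [z] and [w] so that one integral controls the whole Hilbert--Schmidt norm; each factor is in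
    turn a sum of products in the two Cartesian coordinates, and every coordinate contributes one
    logarithm. Since [sing_val] is an approximation number, the finite-rank operator is built
    directly, by compressing to a finite orthonormal family. *)

Lemma cplx_eq x y : Re x = Re y -> Im x = Im y -> x = y.
Proof. by case: x y => [a b] [c d] /= -> ->. Qed.

Lemma Re_add x y : Re (x + y) = Re x + Re y. Proof. by case: x y => [? ?] []. Qed.
Lemma Im_add x y : Im (x + y) = Im x + Im y. Proof. by case: x y => [? ?] []. Qed.
Lemma Re_opp x : Re (- x) = - Re x. Proof. by case: x. Qed.
Lemma Im_opp x : Im (- x) = - Im x. Proof. by case: x. Qed.
Lemma Re_mul x y : Re (x * y) = Re x * Re y - Im x * Im y.
Proof. by case: x y => [? ?] []. Qed.
Lemma Im_mul x y : Im (x * y) = Re x * Im y + Im x * Re y.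
Proof. by case: x y => [? ?] []. Qed.
Lemma Re_conj x : Re (cconj x) = Re x. Proof. by []. Qed.
Lemma Im_conj x : Im (cconj x) = - Im x. Proof. by []. Qed.
Definition ReImE := (Re_add, Im_add, Re_opp, Im_opp, Re_mul, Im_mul, Re_conj, Im_conj).

Lemma cconjD x y : cconj (x + y) = cconj x + cconj y.
Proof. by apply: cplx_eq; rewrite !ReImE // opprD. Qed.
Lemma cconjM x y : cconj (x * y) = cconj x * cconj y.
Proof. by apply: cplx_eq; rewrite !ReImE; ring. Qed.
Lemma cconjK x : cconj (cconj x) = x.
Proof. by apply: cplx_eq; rewrite !ReImE ?opprK. Qed.
Lemma cconj0 : cconj (0 : C) = 0.
Proof. by apply: cplx_eq; rewrite /= ?oppr0. Qed.
Lemma cconj1 : cconj (1 : C) = 1.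
Proof. by apply: cplx_eq; rewrite /= ?oppr0. Qed.
Lemma cconjX x n : cconj (x ^+ n) = cconj x ^+ n.
Proof. by elim: n => [|n IH]; rewrite ?expr0 ?cconj1 // !exprS cconjM IH. Qed.
Lemma cconj_real a : cconj (Complex a 0) = Complex a 0.
Proof. by apply: cplx_eq; rewrite /= ?oppr0. Qed.
Lemma cconj_sum I (r : seq I) (P : pred I) (F : I -> C) :
  cconj (\sum_(i <- r | P i) F i) = \sum_(i <- r | P i) cconj (F i).
Proof. by apply: (big_morph _ cconjD cconj0). Qed.

Lemma csq_ge0 x : 0 <= csq x. Proof. by rewrite /csq addr_ge0 ?sqr_ge0. Qed.
Lemma csqM x y : csq (x * y) = csq x * csq y.
Proof. by rewrite /csq !ReImE; ring. Qed.
Lemma csqN x : csq (- x) = csq x. Proof. by rewrite /csq !ReImE !sqrrN. Qed.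
Lemma csqC x : csq (cconj x) = csq x. Proof. by rewrite /csq !ReImE sqrrN. Qed.
Lemma csq0 : csq (0 : C) = 0. Proof. by rewrite /csq /= expr0n addr0. Qed.
Lemma csq1 : csq (1 : C) = 1. Proof. by rewrite /csq /= expr0n addr0 expr1n. Qed.
Lemma csqX x n : csq (x ^+ n) = csq x ^+ n.
Proof. by elim: n => [|n IH]; rewrite ?expr0 ?csq1 // !exprS csqM IH. Qed.
Lemma csq_real a : csq (Complex a 0) = a ^+ 2.
Proof. by rewrite /csq /= expr0n addr0. Qed.
Lemma natr_complex n : (n%:R : C) = Complex n%:R 0.
Proof. by elim: n => [|n IH] //; rewrite -!natr1 IH; apply: cplx_eq => //=; rewrite ?addr0. Qed.
Lemma mul_conj x : x * cconj x = Complex (csq x) 0.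
Proof. by apply: cplx_eq; rewrite !ReImE /csq /=; ring. Qed.
Lemma csqD_le x y : csq (x + y) <= 2 * csq x + 2 * csq y.
Proof.
rewrite -subr_ge0 (_ : _ - _ = csq (x - y)) ?csq_ge0 //.
by rewrite /csq !ReImE; ring.
Qed.
Lemma Re_mul_conj_le x y : `|Re (x * cconj y)| <= csq x + csq y.
Proof.
rewrite !ReImE /csq; case: x y => [a b] [c d] /=.
have := (sqr_ge0 (a + c), sqr_ge0 (a - c), sqr_ge0 (b + d), sqr_ge0 (b - d),
  sqr_ge0 (a + d), sqr_ge0 (a - d), sqr_ge0 (b + c), sqr_ge0 (b - c)).
by rewrite !expr2 ler_norml => -[[[[[[[? ?] ?] ?] ?] ?] ?] ?]; apply/andP; split; lra.
Qed.
Lemma Im_mul_conj_le x y : `|Im (x * cconj y)| <= csq x + csq y.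
Proof.
rewrite !ReImE /csq; case: x y => [a b] [c d] /=.
have := (sqr_ge0 (a + c), sqr_ge0 (a - c), sqr_ge0 (b + d), sqr_ge0 (b - d),
  sqr_ge0 (a + d), sqr_ge0 (a - d), sqr_ge0 (b + c), sqr_ge0 (b - c)).
by rewrite !expr2 ler_norml => -[[[[[[[? ?] ?] ?] ?] ?] ?] ?]; apply/andP; split; lra.
Qed.
Lemma csq_eq0 x : csq x = 0 -> x = 0.
Proof.
by move=> /eqP; rewrite /csq paddr_eq0 ?sqr_ge0 // !sqrf_eq0 => /andP[/eqP ? /eqP ?]; apply: cplx_eq.
Qed.
Lemma sqrt_csqD x y : Num.sqrt (csq (x + y)) <= Num.sqrt (csq x) + Num.sqrt (csq y).
Proof.
rewrite -ler_sqr ?nnegrE ?addr_ge0 ?sqrtr_ge0 //.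
rewrite sqrrD !sqr_sqrtr ?csq_ge0 //.
have h : Re (x * cconj y) <= Num.sqrt (csq x) * Num.sqrt (csq y).
  rewrite -sqrtrM ?csq_ge0 // (le_trans (ler_norm _)) // -sqrtr_sqr ler_sqrt ?mulr_ge0 ?csq_ge0 //.
  by rewrite -(csqC y) -csqM /csq lerDl sqr_ge0.
have -> : csq (x + y) = csq x + csq y + Re (x * cconj y) *+ 2.
  by rewrite /csq !ReImE -mulr_natl; ring.
by rewrite [leRHS]addrAC lerD2l lerMn2r.
Qed.

End ComplexNumbers.

(** * Integration over the disc, the inner product, Bessel's identity *)

Section DiscIntegrals.
Variable R : realType.
Local Notation C := R[i].
Local Notation Re := (@complex.Re R).
Local Notation Im := (@complex.Im R).
Local Notation leb := (@lebesgue_measure R).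
Local Notation mu := (leb \x leb)%E.
Local Notation disc := (@disc R).
Local Notation RR := (measurableTypeR R * measurableTypeR R)%type.
Implicit Types (h k : RR -> R) (f g : C -> C).

Lemma measurable_disc : measurable (disc : set RR).
Proof.
have -> : disc = setT `&` (fun p : RR => p.1 ^+ 2 + p.2 ^+ 2) @^-1` `]-oo, 1[.
  by rewrite setTI; apply/seteqP; split => p /=; rewrite in_itv.
have H : measurable_fun setT (fun p : RR => p.1 ^+ 2 + p.2 ^+ 2 : R).
  by apply: measurable_funD; apply: measurable_funX; [exact: measurable_fst|exact: measurable_snd].
exact: H.
Qed.

Lemma disc_area_fin : (mu disc < +oo)%E.
Proof.
have sub : disc `<=` (`[-1, 1]%classic : set R) `*` (`[-1, 1]%classic : set R).
  move=> [x y]; rewrite /Defs.disc /= !in_itv /= => h.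
  by split; apply/andP; split; nra.
apply: (@le_lt_trans _ _ (mu ((`[-1, 1]%classic : set R) `*` (`[-1, 1]%classic : set R)))).
  by apply: le_measure => //; rewrite inE; [exact: measurable_disc|apply: measurableX].
rewrite product_measure1E //.
have E : leb (`[-1, 1]%classic : set R) = 2%:E.
  rewrite lebesgue_measure_itv /= lte_fin ifT; last by lra.
  by rewrite -EFinB; congr (_%:E); ring.
by rewrite [X in (X * _)%E]E [X in (_ * X)%E]E -EFinM ltry.
Qed.

Definition dint h : Prop := mu.-integrable disc (EFin \o h).

Lemma dintD h k : dint h -> dint k -> dint (fun p => h p + k p).
Proof. by move=> ih ik; apply: (integrableD measurable_disc ih ik). Qed.

Lemma dintZ (c : R) h : dint h -> dint (fun p => c * h p).
Proof. by move=> ih; apply: (integrableZl measurable_disc c ih). Qed.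

Lemma dintN h : dint h -> dint (fun p => - h p).
Proof. by move=> /(dintZ (-1)); under [X in dint X]funext do rewrite mulN1r. Qed.

Lemma dint_le h k : measurable_fun (disc : set RR) h -> dint k ->
  (forall p : RR, disc p -> `|h p| <= k p) -> dint h.
Proof.
move=> mh ik hk; apply: (le_integrable measurable_disc _ _ ik).
  exact/measurable_EFinP.
by move=> p dp /=; rewrite lee_fin (le_trans (hk p dp)) // ler_norm.
Qed.

Lemma dint_cst (c : R) : dint (fun=> c).
Proof.
apply: measurable_bounded_integrable => //; first exact: measurable_disc.
  exact: disc_area_fin.
by exists `|c|; split => [|x cx p _]; [exact: num_real|exact: ltW].
Qed.

Lemma dint_bounded h (B : R) : measurable_fun (disc : set RR) h ->
  (forall p, disc p -> `|h p| <= B) -> dint h.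
Proof. by move=> mh hB; exact: (dint_le mh (dint_cst B)). Qed.

Lemma dint_ext h k : (forall p, disc p -> h p = k p) -> dint h -> dint k.
Proof.
move=> hk; rewrite /dint => ih; apply: eq_integrable ih; first exact: measurable_disc.
by move=> p /set_mem dp /=; rewrite hk.
Qed.

Definition dI h : R := Rintegral mu disc h.

Lemma dI_ext h k : (forall p, disc p -> h p = k p) -> dI h = dI k.
Proof. by move=> hk; apply: eq_Rintegral => p /set_mem; exact: hk. Qed.
Lemma dID h k : dint h -> dint k -> dI (fun p => h p + k p) = dI h + dI k.
Proof. by move=> ih ik; rewrite /dI RintegralD //; exact: measurable_disc. Qed.
Lemma dIZ (c : R) h : dint h -> dI (fun p => c * h p) = c * dI h.
Proof. by move=> ih; rewrite /dI RintegralZl //; exact: measurable_disc. Qed.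
Lemma dIN h : dint h -> dI (fun p => - h p) = - dI h.
Proof. by move=> ih; rewrite -mulN1r -dIZ //; apply: dI_ext => p _; rewrite mulN1r. Qed.
Lemma dI_le h k : dint h -> dint k -> (forall p, disc p -> h p <= k p) -> dI h <= dI k.
Proof. by move=> ih ik hk; apply: (le_Rintegral measurable_disc ih ik). Qed.
Lemma dI_ge0 h : (forall p, disc p -> 0 <= h p) -> 0 <= dI h.
Proof. by move=> h0; apply: (@Rintegral_ge0 _ RR). Qed.

Lemma dintE h : dint h -> (\int[mu]_(p in disc) (h p)%:E)%E = (dI h)%:E.
Proof.
move=> ih; rewrite /dI /Rintegral fineK //.
by apply: integrable_fin_num => //; exact: measurable_disc.
Qed.

Definition cmeas f := measurable_fun disc (fun p => Re (f (pt p))) /\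
  measurable_fun disc (fun p => Im (f (pt p))).

Lemma cmeas_cst c : cmeas (fun=> c).
Proof. by split; exact: measurable_cst. Qed.
Lemma cmeas_id : cmeas id.
Proof.
split => /=; apply: (@measurable_funS _ _ _ _ setT) => //.
  exact: measurable_fst.
exact: measurable_snd.
Qed.
Lemma cmeasD f g : cmeas f -> cmeas g -> cmeas (fun z => f z + g z).
Proof.
move=> [f1 f2] [g1 g2]; split.
  by under eq_fun do rewrite Re_add; exact: measurable_funD.
by under eq_fun do rewrite Im_add; exact: measurable_funD.
Qed.
Lemma cmeasM f g : cmeas f -> cmeas g -> cmeas (fun z => f z * g z).
Proof.
move=> [f1 f2] [g1 g2]; split.
  by under eq_fun do rewrite Re_mul; apply: measurable_funB; exact: measurable_funM.
by under eq_fun do rewrite Im_mul; apply: measurable_funD; exact: measurable_funM.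
Qed.
Lemma cmeas_conj f : cmeas f -> cmeas (fun z => cconj (f z)).
Proof. by move=> [f1 f2]; split => //=; exact: measurableT_comp. Qed.
Lemma cmeasZ c f : cmeas f -> cmeas (fun z => c * f z).
Proof. exact/cmeasM/cmeas_cst. Qed.
Lemma cmeasX f n : cmeas f -> cmeas (fun z => f z ^+ n).
Proof.
move=> mf; elim: n => [|n IH]; first exact: cmeas_cst.
by under eq_fun do rewrite exprS; exact: cmeasM.
Qed.
Lemma cmeas_csq f : cmeas f -> measurable_fun disc (fun p => csq (f (pt p))).
Proof. by move=> [f1 f2]; apply: measurable_funD; exact: measurable_funX. Qed.

(** The working form of [L2]: [dI] is a real-valued integral and is additive only on integrable
    functions, so finiteness is turned into integrability once and for all. *)
Lemma L2P f : L2 f <-> cmeas f /\ dint (fun p => csq (f (pt p))).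
Proof.
rewrite /L2 /cmeas -[area (R:=R)]/mu; split.
  move=> [f1 [f2 f3]]; split => //; apply/integrableP; split.
    by apply/measurable_EFinP; exact: cmeas_csq.
  rewrite (_ : (fun x => `|_|%E) = (fun p => (csq (f (pt p)))%:E)) //.
  by apply/funext => p /=; rewrite ger0_norm ?csq_ge0.
move=> [[f1 f2] f3]; split => //; split => //.
by rewrite dintE // ltry.
Qed.

Definition cdint f := dint (fun p => Re (f (pt p))) /\ dint (fun p => Im (f (pt p))).

Lemma cintE f : cint f =
  Complex (dI (fun p => Re (f (pt p))) / pi) (dI (fun p => Im (f (pt p))) / pi).
Proof. by []. Qed.

Lemma cintD f g : cdint f -> cdint g ->
  cint (fun z => f z + g z) = cint f + cint g.
Proof.
move=> [f1 f2] [g1 g2]; apply: cplx_eq; rewrite ReImE !cintE /= -mulrDl; congr (_ / _).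
  by rewrite -dID //; apply: dI_ext => p _; rewrite Re_add.
by rewrite -dID //; apply: dI_ext => p _; rewrite Im_add.
Qed.
Lemma cintZ c f : cdint f -> cint (fun z => c * f z) = c * cint f.
Proof.
move=> [f1 f2]; apply: cplx_eq; rewrite ReImE !cintE /=.
  rewrite !mulrA -mulrBl; congr (_ / _).
  rewrite -(dIZ _ f1) -(dIZ _ f2) -dIN; last exact: dintZ.
  rewrite -dID; [|exact: dintZ|exact/dintN/dintZ].
  by apply: dI_ext => p _; rewrite Re_mul.
rewrite !mulrA -mulrDl; congr (_ / _).
rewrite -(dIZ _ f1) -(dIZ _ f2) -dID; [|exact: dintZ|exact: dintZ].
by apply: dI_ext => p _; rewrite Im_mul.
Qed.
Lemma cint_conj f : cdint f -> cint (fun z => cconj (f z)) = cconj (cint f).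
Proof. by move=> [f1 f2]; apply: cplx_eq; rewrite !cintE //= dIN // mulNr. Qed.
Lemma cdintD f g : cdint f -> cdint g -> cdint (fun z => f z + g z).
Proof.
move=> [f1 f2] [g1 g2]; split.
  by apply: dint_ext (dintD f1 g1) => p _; rewrite Re_add.
by apply: dint_ext (dintD f2 g2) => p _; rewrite Im_add.
Qed.
Lemma cdintZ c f : cdint f -> cdint (fun z => c * f z).
Proof.
move=> [f1 f2]; split.
  by apply: dint_ext (dintD (dintZ (Re c) f1) (dintN (dintZ (Im c) f2))) => p _; rewrite Re_mul.
by apply: dint_ext (dintD (dintZ (Re c) f2) (dintZ (Im c) f1)) => p _; rewrite Im_mul.
Qed.
Lemma cint_ext f g : (forall p, disc p -> f (pt p) = g (pt p)) -> cint f = cint g.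
Proof. by move=> fg; rewrite !cintE; congr Complex; congr (_ / _); apply: dI_ext => p dp; rewrite fg. Qed.

Lemma L2_meas f : L2 f -> cmeas f. Proof. by case/L2P. Qed.
Lemma L2_csq f : L2 f -> dint (fun p => csq (f (pt p))). Proof. by case/L2P. Qed.

Lemma L2_dom f g (c : R) : cmeas f -> L2 g ->
  (forall p, disc p -> csq (f (pt p)) <= c * csq (g (pt p))) -> L2 f.
Proof.
move=> mf /L2P[mg ig] fg; apply/L2P; split => //.
apply: dint_le (dintZ c ig) _; first exact: cmeas_csq.
by move=> p dp; rewrite ger0_norm ?csq_ge0 // fg.
Qed.

Lemma L2_bounded f (B : R) : cmeas f -> (forall p, disc p -> csq (f (pt p)) <= B) -> L2 f.
Proof.
move=> mf fB; apply/L2P; split => //; apply: (@dint_bounded _ B); first exact: cmeas_csq.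
by move=> p dp; rewrite ger0_norm ?csq_ge0 // fB.
Qed.

Lemma L2D f g : L2 f -> L2 g -> L2 (fun z => f z + g z).
Proof.
move=> /L2P[mf cf] /L2P[mg cg]; apply/L2P; split; first exact: cmeasD.
apply: dint_le (dintD (dintZ 2 cf) (dintZ 2 cg)) _; first exact: (cmeas_csq (cmeasD mf mg)).
by move=> p _; rewrite ger0_norm ?csq_ge0 //; exact: csqD_le.
Qed.
Lemma L2Z c f : L2 f -> L2 (fun z => c * f z).
Proof.
move=> Lf; apply: (@L2_dom _ f (csq c)) => //; first exact/cmeasZ/L2_meas.
by move=> p _; rewrite csqM.
Qed.
Lemma L2_ext f g : (forall p, disc p -> f (pt p) = g (pt p)) -> L2 f -> L2 g.
Proof.
move=> fg /L2P[[m1 m2] cf]; apply/L2P; split; last first.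
  by apply: dint_ext cf => p dp; rewrite fg.
split; [apply: eq_measurable_fun m1|apply: eq_measurable_fun m2];
  by move=> p /set_mem dp; rewrite fg.
Qed.
Lemma L2B f g : L2 f -> L2 g -> L2 (fun z => f z - g z).
Proof.
move=> Lf Lg; apply: L2_ext (L2D Lf (L2Z (-1) Lg)) => p _ /=.
by rewrite mulN1r.
Qed.
Lemma L2_0 : L2 (fun=> 0 : C).
Proof. by apply: (@L2_bounded _ 0); [exact: cmeas_cst|move=> p _; rewrite csq0]. Qed.
Lemma L2_sum n (F : nat -> C -> C) : (forall i, (i < n)%N -> L2 (F i)) ->
  L2 (fun z => \sum_(i < n) F i z).
Proof.
elim: n => [|n IH] LF; first by apply: L2_ext L2_0 => p _; rewrite big_ord0.
have := L2D (IH (fun i ni => LF i (ltnW ni))) (LF n (ltnSn n)).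
by apply: L2_ext => p _; rewrite big_ord_recr.
Qed.

Lemma cdint_prod f g : L2 f -> L2 g -> cdint (fun z => f z * cconj (g z)).
Proof.
move=> /L2P[mf cf] /L2P[mg cg]; have [m1 m2] := cmeasM mf (cmeas_conj mg).
split; apply: dint_le (dintD cf cg) _ => // p _.
  exact: Re_mul_conj_le.
exact: Im_mul_conj_le.
Qed.

Lemma inner_ext f g f' g' : (forall p, disc p -> f (pt p) = f' (pt p)) ->
  (forall p, disc p -> g (pt p) = g' (pt p)) -> inner f g = inner f' g'.
Proof. by move=> ff gg; apply: cint_ext => p dp; rewrite ff // gg. Qed.

Lemma innerC f g : L2 f -> L2 g -> inner g f = cconj (inner f g).
Proof.
move=> Lf Lg; rewrite /inner -cint_conj; last exact: cdint_prod.
by apply: cint_ext => p _; rewrite cconjM cconjK mulrC.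
Qed.
Lemma innerDl f g (h : C -> C) : L2 f -> L2 g -> L2 h ->
  inner (fun z => f z + g z) h = inner f h + inner g h.
Proof.
move=> Lf Lg Lh; rewrite /inner -cintD; [|exact: cdint_prod|exact: cdint_prod].
by apply: cint_ext => p _; rewrite mulrDl.
Qed.
Lemma innerZl c f (h : C -> C) : L2 f -> L2 h -> inner (fun z => c * f z) h = c * inner f h.
Proof.
move=> Lf Lh; rewrite /inner -cintZ; last exact: cdint_prod.
by apply: cint_ext => p _; rewrite mulrA.
Qed.
Lemma innerBl f g (h : C -> C) : L2 f -> L2 g -> L2 h ->
  inner (fun z => f z - g z) h = inner f h - inner g h.
Proof.
move=> Lf Lg Lh; rewrite -[- inner g h]mulN1r -innerZl // -innerDl //; last exact: L2Z.
by apply: inner_ext => p _ //; rewrite mulN1r.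
Qed.
Lemma innerDr f g (h : C -> C) : L2 f -> L2 g -> L2 h ->
  inner h (fun z => f z + g z) = inner h f + inner h g.
Proof.
move=> Lf Lg Lh; rewrite !(innerC _ Lh) ?innerDl ?cconjD //; exact: L2D.
Qed.
Lemma innerZr c f (h : C -> C) : L2 f -> L2 h -> inner h (fun z => c * f z) = cconj c * inner h f.
Proof. by move=> Lf Lh; rewrite !(innerC _ Lh) ?innerZl ?cconjM //; exact: L2Z. Qed.
Lemma innerBr f g (h : C -> C) : L2 f -> L2 g -> L2 h ->
  inner h (fun z => f z - g z) = inner h f - inner h g.
Proof.
move=> Lf Lg Lh; rewrite !(innerC _ Lh) ?innerBl //; last exact: L2B.
by apply: cplx_eq; rewrite !ReImE // opprD.
Qed.
Lemma inner0l (h : C -> C) : inner (fun=> 0) h = 0.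
Proof.
rewrite /inner (@cint_ext _ (fun z => 0 * 0)) ?cintZ ?mul0r //.
  by split; apply: dint_cst.
by move=> p _; rewrite !mul0r.
Qed.
Lemma inner_suml n (F : nat -> C -> C) (h : C -> C) : (forall i, (i < n)%N -> L2 (F i)) -> L2 h ->
  inner (fun z => \sum_(i < n) F i z) h = \sum_(i < n) inner (F i) h.
Proof.
move=> LF Lh; elim: n LF => [|n IH] LF.
  by rewrite big_ord0 -[RHS](inner0l h); apply: inner_ext => p _ //; rewrite big_ord0.
have LF' i : (i < n)%N -> L2 (F i) by move=> ni; apply: LF; exact: ltnW.
rewrite big_ord_recr /= -IH // -innerDl //; [|exact: L2_sum|exact: LF].
by apply: inner_ext => p _ //; rewrite big_ord_recr.
Qed.

Definition nsq f : R := Re (inner f f).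

Lemma nsqE f : nsq f = dI (fun p => csq (f (pt p))) / pi.
Proof.
rewrite /nsq /inner cintE /=; congr (_ / _); apply: dI_ext => p _.
by rewrite mul_conj.
Qed.
Lemma nsq_ge0 f : 0 <= nsq f.
Proof. by rewrite nsqE divr_ge0 ?pi_ge0 // dI_ge0 // => p _; exact: csq_ge0. Qed.
Lemma inner_self f : L2 f -> inner f f = Complex (nsq f) 0.
Proof.
move=> Lf; apply: cplx_eq; first by [].
have /(congr1 Im) := innerC Lf Lf; rewrite Im_conj => h.
have -> : Im (inner f f) = 0 by lra.
by [].
Qed.
Lemma nsq_dom f g (c : R) : 0 <= c -> cmeas f -> L2 g ->
  (forall p, disc p -> csq (f (pt p)) <= c * csq (g (pt p))) -> nsq f <= c * nsq g.
Proof.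
move=> c0 mf Lg fg; rewrite !nsqE mulrA ler_pM2r ?invr_gt0 ?pi_gt0 // -dIZ; last exact: L2_csq.
by apply: dI_le => //; [exact/L2_csq/(L2_dom mf Lg fg)|exact/dintZ/L2_csq].
Qed.
Lemma nsq_ext f g : (forall p, disc p -> f (pt p) = g (pt p)) -> nsq f = nsq g.
Proof. by move=> fg; congr (Re _); apply: inner_ext. Qed.
Lemma nsqZ c f : L2 f -> nsq (fun z => c * f z) = csq c * nsq f.
Proof.
move=> Lf; rewrite /nsq innerZl ?innerZr //; last exact: L2Z.
by rewrite inner_self // !ReImE /csq /=; ring.
Qed.
Lemma nsqB f g : L2 f -> L2 g ->
  nsq (fun z => f z - g z) = nsq f + nsq g - 2 * Re (inner f g).
Proof.
move=> Lf Lg; have LB := L2B Lf Lg.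
rewrite /nsq innerBl ?innerBr // (innerC Lf Lg) !ReImE.
by ring.
Qed.

Lemma cauchy_schwarz f g : L2 f -> L2 g -> csq (inner f g) <= nsq f * nsq g.
Proof.
move=> Lf Lg.
(* This expands [nsq (f - t <f,g> g) >= 0]; the phase sits in the factor [<f,g>], so a real [t] is
   enough. *)
have key (t : R) : 0 <= nsq f + t ^+ 2 * csq (inner f g) * nsq g - 2 * t * csq (inner f g).
  have := nsq_ge0 (fun z => f z - (Complex t 0 * inner f g) * g z).
  rewrite nsqB ?nsqZ //; last exact: L2Z.
  rewrite innerZr // csqM csq_real cconjM cconj_real.
  move: (inner f g) => [a b]; rewrite !ReImE /csq /= => h.
  by apply: le_trans h _; rewrite le_eqVlt; apply/orP; left; apply/eqP; ring.
have [g0|g0] := eqVneq (nsq g) 0.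
  have h := csq_ge0 (inner f g); have n0 := nsq_ge0 f.
  rewrite g0 mulr0; rewrite leNgt; apply/negP => c0.
  (* With [nsq g = 0] the inequality is affine in [t], and this [t] makes the subtracted term equal
     to [nsq f + 1]. *)
  have := key ((nsq f + 1) / (2 * csq (inner f g))).
  rewrite g0 mulr0 addr0 (_ : 2 * _ * _ = nsq f + 1); last by field; lra.
  by lra.
have gp : 0 < nsq g by rewrite lt_neqAle eq_sym g0 nsq_ge0.
have := key (nsq g)^-1.
rewrite (_ : nsq f + _ - _ = (nsq f * nsq g - csq (inner f g)) / nsq g); last by field.
by rewrite pmulr_lge0 ?invr_gt0 // subr_ge0.
Qed.

Lemma Re_inner_le f g : L2 f -> L2 g -> Re (inner f g) <= Num.sqrt (nsq f) * Num.sqrt (nsq g).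
Proof.
move=> Lf Lg; rewrite -sqrtrM ?nsq_ge0 // (le_trans (ler_norm _)) // -sqrtr_sqr.
have le2 : Re (inner f g) ^+ 2 <= nsq f * nsq g.
  by apply: (le_trans _ (cauchy_schwarz Lf Lg)); rewrite /csq lerDl sqr_ge0.
exact: ler_wsqrtr.
Qed.

Lemma norm2E f : norm2 f = Num.sqrt (nsq f). Proof. by []. Qed.

Lemma norm2D f g : L2 f -> L2 g -> norm2 (fun z => f z + g z) <= norm2 f + norm2 g.
Proof.
move=> Lf Lg; rewrite !norm2E -ler_sqr ?nnegrE ?addr_ge0 ?sqrtr_ge0 //.
rewrite sqrrD !sqr_sqrtr ?nsq_ge0 // {1}/nsq innerDl ?innerDr //; [|exact: L2D].
rewrite (innerC Lf Lg) !ReImE -/(nsq f) -/(nsq g); have := Re_inner_le Lf Lg.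
by rewrite mulr2n; lra.
Qed.

(** Induction on [m]: [e m] is orthogonal to the earlier terms, so the previous residual has the
    same coefficient along [e m] as [f] itself. Orthonormality is asked below [m] only, because the
    greedy families met later are orthonormal only that far. The exact identity, and not just
    Bessel's inequality, gives the norms of tails of series. *)
Lemma bessel_residual (e : nat -> C -> C) f m :
  (forall i, (i < m)%N -> L2 (e i)) -> L2 f ->
  (forall i j, (i < m)%N -> (j < m)%N -> inner (e i) (e j) = (i == j)%:R) ->
  nsq (fun z => f z - \sum_(i < m) inner f (e i) * e i z)
    = nsq f - \sum_(i < m) csq (inner f (e i)).
Proof.
move=> + Lf; elim: m => [|m IH] Le oe.
  rewrite big_ord0 subr0; apply: nsq_ext => p _; rewrite big_ord0 subr0 //.
have Le' i : (i < m)%N -> L2 (e i) by move=> im; apply: Le; exact: ltnW.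
have Lm := Le m (ltnSn m).
have LS : L2 (fun z => \sum_(i < m) inner f (e i) * e i z).
  by apply: (L2_sum (F := fun i z => inner f (e i) * e i z)) => i im; exact/L2Z/Le'.
rewrite big_ord_recr /= opprD addrA -IH; [|exact: Le'|by move=> i j im jm; apply: oe; exact: ltnW].
pose S z := \sum_(i < m) inner f (e i) * e i z; pose r z := f z - S z.
have rm : inner r (e m) = inner f (e m).
  rewrite innerBl // (inner_suml (F := fun i z => inner f (e i) * e i z)) //; last first.
    by move=> i im; exact/L2Z/Le'.
  rewrite big1 ?subr0 // => i _; rewrite innerZl // ?oe ?ltnS ?(ltnW (ltn_ord i)) //.
    by rewrite ltn_eqF // mulr0.
  exact: Le'.
have Lr : L2 r by exact: L2B.
transitivity (nsq (fun z => r z - inner f (e m) * e m z)).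
  by apply: nsq_ext => p _; rewrite big_ord_recr /= opprD addrA.
rewrite nsqB //; last exact: L2Z.
rewrite nsqZ // innerZr // rm /nsq oe // eqxx [cconj _ * _]mulrC mul_conj /=.
by ring.
Qed.

Lemma bessel_le (e : nat -> C -> C) f m :
  (forall i, (i < m)%N -> L2 (e i)) -> L2 f ->
  (forall i j, (i < m)%N -> (j < m)%N -> inner (e i) (e j) = (i == j)%:R) ->
  \sum_(i < m) csq (inner f (e i)) <= nsq f.
Proof. by move=> Le Lf oe; rewrite -subr_ge0 -bessel_residual // nsq_ge0. Qed.

End DiscIntegrals.

(** * Green's formula on discs by slicing *)

Section SliceIntegrals.
Variable R : realType.
Local Notation leb := (@lebesgue_measure R).
Local Notation mu := (leb \x leb)%E.
Local Notation disc := (@disc R).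
Local Notation RR := (measurableTypeR R * measurableTypeR R)%type.

Definition has_der (f f' : R -> R) := forall t : R, is_derive t (1 : R) f (f' t).

Lemma has_derD f f' g g' : has_der f f' -> has_der g g' ->
  has_der (fun t => f t + g t) (fun t => f' t + g' t).
Proof. by move=> hf hg t; exact: (is_deriveD (hf t) (hg t)). Qed.
Lemma has_derB f f' g g' : has_der f f' -> has_der g g' ->
  has_der (fun t => f t - g t) (fun t => f' t - g' t).
Proof. by move=> hf hg t; exact: (is_deriveB (hf t) (hg t)). Qed.
Lemma has_derN f f' : has_der f f' -> has_der (fun t => - f t) (fun t => - f' t).
Proof. by move=> hf t; exact: (is_deriveN (hf t)). Qed.
Lemma has_derM f f' g g' : has_der f f' -> has_der g g' ->
  has_der (fun t => f t * g t) (fun t => f' t * g t + f t * g' t).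
Proof.
move=> hf hg t; apply: (is_derive_eq (is_deriveM (hf t) (hg t))).
by rewrite addrC /GRing.scale /= [g t * _]mulrC.
Qed.
Lemma has_der_cst c : has_der (fun=> c) (fun=> 0).
Proof. by move=> t; exact: is_derive_cst. Qed.
Lemma has_der_id : has_der id (fun=> 1).
Proof. by move=> t; exact: is_derive_id. Qed.
Lemma has_der_ext f f' g' : (forall t, f' t = g' t) -> has_der f f' -> has_der f g'.
Proof. by move=> e hf t; rewrite -e. Qed.

Lemma has_der_continuous f f' : has_der f f' -> continuous f.
Proof. by move=> hf t; apply/differentiable_continuous/derivable1_diffP; have [] := hf t. Qed.

Lemma ftc_symmetric f f' (a : R) : has_der f f' -> continuous f' -> 0 < a ->
  f a = f (- a) -> (\int[leb]_(x in `](- a)%R, a[) (f' x)%:E = 0)%E.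
Proof.
move=> df cf a0 fa.
have mf' : measurable_fun (setT : set R) f' by exact: continuous_measurable_fun.
rewrite -(@integral_itv_bndoo _ _ _ _ true false); last first.
  by apply/measurable_EFinP; exact: measurable_funS mf'.
rewrite (@continuous_FTC2 _ f' f) ?fa ?subee //.
- by lra.
- exact: continuous_subspaceT.
- split.
  + by move=> x _; have [] := df x.
  + exact/cvg_at_right_filter/(has_der_continuous df).
  + exact/cvg_at_left_filter/(has_der_continuous df).
- by move=> x _; rewrite derive1E; have [] := df x.
Qed.

(** Extension by zero, so that Fubini can be applied on the whole plane to integrals over the disc
    of radius [r]. *)
Definition cut (r : R) (h : RR -> R) (p : RR) : R :=
  if p.1 ^+ 2 + p.2 ^+ 2 < r ^+ 2 then h p else 0.

Lemma measurable_cut r h : measurable_fun (disc : set RR) h -> measurable_fun (disc : set RR) (cut r h).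
Proof.
move=> mh; apply: measurable_fun_if => //.
- exact: measurable_disc.
- apply: (@measurable_funS _ _ _ _ setT) => //.
  apply: measurable_fun_ltr; last exact: measurable_cst.
  by apply: measurable_funD; apply: measurable_funX; [exact: measurable_fst|exact: measurable_snd].
- by apply: (measurable_funS _ _ mh); [exact: measurable_disc|exact: subIsetl].
Qed.

(** The slice at height [c] is empty, or the interval []-a, a[] with [a ^ 2 = r ^ 2 - c ^ 2]. Both
    ends lie on the circle, where [f] vanishes, so the fundamental theorem gives 0. *)
Lemma cut_slice_int f f' (r c : R) : 0 < r -> has_der f f' -> continuous f' ->
  (forall x, x ^+ 2 + c ^+ 2 = r ^+ 2 -> f x = 0) ->
  (\int[leb]_x (if x ^+ 2 + c ^+ 2 < r ^+ 2 then f' x else 0)%:E = 0)%E.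
Proof.
move=> r0 df cf f0; have [rc|cr] := leP (r ^+ 2) (c ^+ 2).
  apply: integral0_eq => x _; rewrite ifF //; apply/negbTE; rewrite -leNgt.
  by rewrite (le_trans rc) // lerDr sqr_ge0.
pose a := Num.sqrt (r ^+ 2 - c ^+ 2).
have a0 : 0 < a by rewrite sqrtr_gt0 subr_gt0.
have a2 : a ^+ 2 = r ^+ 2 - c ^+ 2 by rewrite sqr_sqrtr // subr_ge0 ltW.
have fa : f a = f (- a) by rewrite !f0 // ?sqrrN a2 subrK.
rewrite -(ftc_symmetric df cf a0 fa) [RHS]integral_mkcond; apply: eq_integral => x _.
rewrite patchE (_ : (x ^+ 2 + c ^+ 2 < r ^+ 2) = (x \in `]-a, a[%classic)); first by case: ifP.
rewrite -ltrBrDr -a2 mem_setE in_itv /= -ltr_norml -[RHS](@ltr_pXn2r _ 2) ?nnegrE ?normr_ge0 ?ltW //.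
by rewrite real_normK ?num_real.
Qed.

Section Green.
Variables (f f' : RR -> R) (r B : R).
Hypothesis r01 : 0 < r <= 1.
Hypothesis mf' : measurable_fun (disc : set RR) f'.
Hypothesis bf' : forall p, disc p -> `|f' p| <= B.
Hypothesis f0 : forall p, p.1 ^+ 2 + p.2 ^+ 2 = r ^+ 2 -> f p = 0.

Let int_cut : mu.-integrable setT (EFin \o (cut r f')).
Proof.
have ic : dint (cut r f').
  apply: (@dint_bounded _ _ B); first exact: measurable_cut.
  move=> p dp; rewrite /cut; case: ifP => _; first exact: bf'.
  by rewrite normr0 (le_trans _ (bf' dp)).
have ic' : mu.-integrable setT ((EFin \o cut r f') \_ disc).
  by apply/(integrable_mkcond _ (@measurable_disc R)).
move: ic'; congr (_.-integrable _ _); apply/funext => p; rewrite patchE /cut /=; case: ifPn => // pd.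
rewrite ifF //; apply/negbTE; move: pd; rewrite notin_setE /Defs.disc /= => /negP.
rewrite -!leNgt => h; apply: le_trans h; have /andP[? ?] := r01; nra.
Qed.

Let dI_cut : dI (cut r f') = fine (\int[mu]_p (cut r f' p)%:E)%E.
Proof.
rewrite /dI /Rintegral integral_mkcond; congr fine; apply: eq_integral => p _.
rewrite patchE /cut /=; case: ifPn => // pd.
rewrite ifF //; apply/negbTE; move: pd; rewrite notin_setE /Defs.disc /= => /negP.
rewrite -!leNgt => h; apply: le_trans h; have /andP[? ?] := r01; nra.
Qed.

(** Since [r <= 1], the cut function vanishes off the unit disc, and its integral over the disc is
    one over the plane. Boundedness of [f'] allows Fubini, and every horizontal slice integrates to
    0. *)
Lemma green_x : (forall y, has_der (fun x => f (x, y)) (fun x => f' (x, y))) ->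
  (forall y, continuous (fun x : R => f' (x, y))) -> dI (cut r f') = 0.
Proof.
move=> df cf; rewrite dI_cut -(integral21_prod_meas1 int_cut) integral0_eq // => y _.
rewrite /fubini_G /cut /=; have /andP[r0 _] := r01.
by apply: (cut_slice_int r0 (df y) (cf y)) => x h; exact: f0.
Qed.

Lemma green_y : (forall x, has_der (fun y => f (x, y)) (fun y => f' (x, y))) ->
  (forall x, continuous (fun y : R => f' (x, y))) -> dI (cut r f') = 0.
Proof.
move=> df cf; rewrite dI_cut -(integral12_prod_meas1 int_cut) integral0_eq // => x _.
rewrite /fubini_F /cut /=; have /andP[r0 _] := r01.
under eq_integral do rewrite addrC.
by apply: (cut_slice_int r0 (df x) (cf x)) => y h; apply: f0; rewrite addrC.
Qed.

End Green.

End SliceIntegrals.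

(** * Moments of discs and orthogonality of monomials *)

Section Monomials.
Variable R : realType.
Local Notation C := R[i].
Local Notation Re := (@complex.Re R).
Local Notation Im := (@complex.Im R).
Local Notation leb := (@lebesgue_measure R).
Local Notation mu := (leb \x leb)%E.
Local Notation disc := (@disc R).
Local Notation RR := (measurableTypeR R * measurableTypeR R)%type.

(* [wder u v e] is [u * d_z e + v * d_zbar e]; thus [u = 1, v = 1] gives [d_x] and
   [u = i, v = - i] gives [d_y]. *)
Inductive wpoly := WZ | WZb | WC of C | WAdd of wpoly & wpoly | WMul of wpoly & wpoly.

Fixpoint weval e (z : C) : C := match e with
  | WZ => z | WZb => cconj z | WC c => c
  | WAdd a b => weval a z + weval b z | WMul a b => weval a z * weval b z end.
Fixpoint wder (u v : C) e : wpoly := match e with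
  | WZ => WC u | WZb => WC v | WC c => WC 0
  | WAdd a b => WAdd (wder u v a) (wder u v b)
  | WMul a b => WAdd (WMul (wder u v a) b) (WMul a (wder u v b)) end.
Fixpoint wpow e n := if n is n'.+1 then WMul e (wpow e n') else WC 1.

Lemma weval_pow e n z : weval (wpow e n) z = weval e z ^+ n.
Proof. by elim: n => //= n ->; rewrite exprS. Qed.

Lemma wder_pow u v e n z :
  weval (wder u v (wpow e n)) z = n%:R * weval e z ^+ n.-1 * weval (wder u v e) z.
Proof.
elim: n => [|n IH] /=; first by rewrite !mul0r.
rewrite IH weval_pow; case: n {IH} => [|n] /=; rewrite ?expr0 ?exprS -?natr1; ring.
Qed.

Lemma wderE u v e z :
  weval (wder u v e) z = u * weval (wder 1 0 e) z + v * weval (wder 0 1 e) z.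
Proof.
by elim: e => [||c|a IHa b IHb|a IHa b IHb] /=; rewrite ?IHa ?IHb; ring.
Qed.

Lemma weval_meas e : cmeas (weval e).
Proof.
elim: e => [||c|a IHa b IHb|a IHa b IHb] /=.
- exact: cmeas_id.
- exact/cmeas_conj/cmeas_id.
- exact: cmeas_cst.
- exact: cmeasD.
- exact: cmeasM.
Qed.

Lemma weval_bounded e : exists2 B, 0 <= B & forall p, disc p -> csq (weval e (pt p)) <= B.
Proof.
elim: e => [||c|a [A A0 hA] b [B B0 hB]|a [A A0 hA] b [B B0 hB]] /=.
- by exists 1 => // p; rewrite /Defs.disc /csq /= => /ltW.
- by exists 1 => // p; rewrite csqC /Defs.disc /csq /= => /ltW.
- by exists (csq c) => //; exact: csq_ge0.
- exists (2 * A + 2 * B); first by lra.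
  by move=> p dp; apply: le_trans (csqD_le _ _) _; have := hA p dp; have := hB p dp; lra.
- exists (A * B); first exact: mulr_ge0.
  by move=> p dp; rewrite csqM ler_pM ?csq_ge0 ?hA ?hB.
Qed.

(** Chain rule along a line of velocity [u]. There [cconj z] moves with velocity [cconj u], which is
    why the formal derivative is a real one exactly in the case [v = cconj u]. *)
Lemma wder_der (l : R -> RR) (u v : C) e :
  has_der (fun t => Re (pt (l t))) (fun=> Re u) -> has_der (fun t => Im (pt (l t))) (fun=> Im u) ->
  cconj u = v ->
  has_der (fun t => Re (weval e (pt (l t)))) (fun t => Re (weval (wder u v e) (pt (l t)))) /\
  has_der (fun t => Im (weval e (pt (l t)))) (fun t => Im (weval (wder u v e) (pt (l t)))).
Proof.
move=> hR hI <-; elim: e => [||c|a [IHa JHa] b [IHb JHb]|a [IHa JHa] b [IHb JHb]] /=.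
- by split.
- by split => //; exact: has_derN.
- by split; exact: has_der_cst.
- split.
  + under eq_fun do rewrite Re_add.
    by apply: has_der_ext (has_derD IHa IHb) => t; rewrite Re_add.
  + under eq_fun do rewrite Im_add.
    by apply: has_der_ext (has_derD JHa JHb) => t; rewrite Im_add.
- split.
  + under eq_fun do rewrite Re_mul.
    apply: has_der_ext (has_derB (has_derM IHa IHb) (has_derM JHa JHb)) => t.
    by rewrite !ReImE; ring.
  + under eq_fun do rewrite Im_mul.
    apply: has_der_ext (has_derD (has_derM IHa JHb) (has_derM JHa IHb)) => t.
    by rewrite !ReImE; ring.
Qed.

Definition ccut (r : R) (z : C) : C := if csq z < r ^+ 2 then 1 else 0.

Lemma ccut_conj r z : cconj (ccut r z) = ccut r z.
Proof. by rewrite /ccut; case: ifP; rewrite ?cconj1 ?cconj0. Qed.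
Lemma ccut_sq r z : ccut r z * ccut r z = ccut r z.
Proof. by rewrite /ccut; case: ifP; rewrite ?mulr1 ?mulr0. Qed.
Lemma csq_ccut_le r z : csq (ccut r z) <= 1.
Proof. by rewrite /ccut; case: ifP; rewrite ?csq1 ?csq0 ?ler01. Qed.
Lemma Re_ccut r p (w : C) : Re (ccut r (pt p) * w) = cut r (fun=> Re w) p.
Proof. by rewrite /ccut /cut /csq /=; case: ifP; rewrite ?mul1r ?mul0r. Qed.
Lemma Im_ccut r p (w : C) : Im (ccut r (pt p) * w) = cut r (fun=> Im w) p.
Proof. by rewrite /ccut /cut /csq /=; case: ifP; rewrite ?mul1r ?mul0r. Qed.
Lemma cmeas_ccut r : cmeas (ccut r).
Proof.
split.
  have := @measurable_cut R r (fun=> 1) (measurable_cst _).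
  by apply: eq_measurable_fun => p _; rewrite -[ccut _ _]mulr1 Re_ccut.
have := @measurable_cut R r (fun=> 0) (measurable_cst _).
by apply: eq_measurable_fun => p _; rewrite -[ccut _ _]mulr1 Im_ccut.
Qed.

Lemma cint_ccut r f : cint (fun z => ccut r z * f z) =
  Complex (dI (cut r (fun p => Re (f (pt p)))) / pi) (dI (cut r (fun p => Im (f (pt p)))) / pi).
Proof.
rewrite cintE; congr Complex; congr (_ / _); apply: dI_ext => p _.
  by rewrite Re_ccut.
by rewrite Im_ccut.
Qed.

Lemma Re_sqr_le (z : C) : Re z ^+ 2 <= csq z. Proof. by rewrite /csq lerDl sqr_ge0. Qed.
Lemma Im_sqr_le (z : C) : Im z ^+ 2 <= csq z. Proof. by rewrite /csq lerDr sqr_ge0. Qed.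
Lemma norm_le_sqrt (x B : R) : x ^+ 2 <= B -> `|x| <= Num.sqrt B.
Proof. by move=> xB; rewrite -sqrtr_sqr ler_wsqrtr. Qed.

Lemma green_dir (e : wpoly) (r : R) (u : C) : 0 < r <= 1 ->
  (u = 1 \/ u = Complex 0 1) ->
  (forall z, csq z = r ^+ 2 -> weval e z = 0) ->
  cint (fun z => ccut r z * weval (wder u (cconj u) e) z) = 0.
Proof.
move=> r01 hu e0; set d := wder u _ e.
have [mR mI] := weval_meas d; have [B B0 hB] := weval_bounded d.
have bR p : disc p -> `|Re (weval d (pt p))| <= Num.sqrt B.
  by move=> dp; apply/norm_le_sqrt/(le_trans (Re_sqr_le _))/hB.
have bI p : disc p -> `|Im (weval d (pt p))| <= Num.sqrt B.
  by move=> dp; apply/norm_le_sqrt/(le_trans (Im_sqr_le _))/hB.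
have eR (p : RR) : p.1 ^+ 2 + p.2 ^+ 2 = r ^+ 2 -> Re (weval e (pt p)) = 0.
  by move=> h; rewrite e0.
have eI (p : RR) : p.1 ^+ 2 + p.2 ^+ 2 = r ^+ 2 -> Im (weval e (pt p)) = 0.
  by move=> h; rewrite e0.
rewrite cint_ccut; case: hu => uE.
  have hx y : let l t : RR := (t, y) in
      has_der (fun t => Re (pt (l t))) (fun=> Re u) /\
      has_der (fun t => Im (pt (l t))) (fun=> Im u).
    by rewrite uE; split; [exact: has_der_id|exact: has_der_cst].
  have H y := wder_der e (hx y).1 (hx y).2 erefl.
  have H' y := wder_der d (hx y).1 (hx y).2 erefl.
  rewrite (@green_x R (fun p => Re (weval e (pt p))) _ _ (Num.sqrt B)) //.
  - rewrite (@green_x R (fun p => Im (weval e (pt p))) _ _ (Num.sqrt B)) // ?mul0r //.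
    + by move=> y; have [] := H y.
    + by move=> y; have [_ /has_der_continuous] := H' y.
  - by move=> y; have [] := H y.
  - by move=> y; have [/has_der_continuous] := H' y.
have hx x : let l t : RR := (x, t) in
    has_der (fun t => Re (pt (l t))) (fun=> Re u) /\
    has_der (fun t => Im (pt (l t))) (fun=> Im u).
  by rewrite uE; split; [exact: has_der_cst|exact: has_der_id].
have H y := wder_der e (hx y).1 (hx y).2 erefl.
have H' y := wder_der d (hx y).1 (hx y).2 erefl.
rewrite (@green_y R (fun p => Re (weval e (pt p))) _ _ (Num.sqrt B)) //.
- rewrite (@green_y R (fun p => Im (weval e (pt p))) _ _ (Num.sqrt B)) // ?mul0r //.
  + by move=> y; have [] := H y.
  + by move=> y; have [_ /has_der_continuous] := H' y.
- by move=> y; have [] := H y.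
- by move=> y; have [/has_der_continuous] := H' y.
Qed.

Lemma cdint_ccut_weval r e : cdint (fun z => ccut r z * weval e z).
Proof.
have [mR mI] := cmeasM (cmeas_ccut r) (weval_meas e); have [B B0 hB] := weval_bounded e.
have b p : disc p -> csq (ccut r (pt p) * weval e (pt p)) <= B.
  by move=> dp; rewrite csqM -[B]mul1r ler_pM ?csq_ge0 ?csq_ccut_le ?hB.
split; apply: (@dint_bounded _ _ (Num.sqrt B)) => // p dp.
  exact/norm_le_sqrt/(le_trans (Re_sqr_le _))/b.
exact/norm_le_sqrt/(le_trans (Im_sqr_le _))/b.
Qed.

(* [d_zbar] is [(d_x + i d_y) / 2], and a slice integral of [d_x e] is a difference of two
   boundary values of [e]. *)
Lemma green_dbar (e : wpoly) (r : R) : 0 < r <= 1 ->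
  (forall z, csq z = r ^+ 2 -> weval e z = 0) ->
  cint (fun z => ccut r z * weval (wder 0 1 e) z) = 0.
Proof.
move=> r01 e0; pose i : C := Complex 0 1.
have ii : i * i = -1 by apply: cplx_eq; rewrite /= ?mulr0 ?mul0r ?mulr1 ?sub0r ?addr0 ?oppr0.
have hx := green_dir r01 (or_introl erefl) e0.
have hy := green_dir r01 (or_intror erefl) e0.
transitivity (cint (fun z => 2^-1 * (ccut r z * weval (wder 1 (cconj 1) e) z +
    i * (ccut r z * weval (wder i (cconj i) e) z)))).
  apply: cint_ext => p _; rewrite [in RHS]wderE [weval (wder i _ e) _]wderE cconj1.
  have -> : cconj i = - i by apply: cplx_eq; rewrite /= ?oppr0.
  set a := weval _ _; set b := weval _ _; set c := ccut _ _.
  transitivity (2^-1 * c * ((1 + i * i) * b + (1 - i * i) * a)); last by ring.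
  by rewrite ii addrN mul0r add0r opprK; field.
have c1 := cdint_ccut_weval r (wder 1 (cconj 1) e).
have c2 := cdintZ i (cdint_ccut_weval r (wder i (cconj i) e)).
rewrite cintZ; last exact: cdintD.
by rewrite cintD // cintZ ?hx ?hy ?mulr0 ?addr0 ?mulr0 //; exact: cdint_ccut_weval.
Qed.

(** Moments are needed for every radius up to 1: a power series is controlled only on smaller discs,
    and the full disc is reached by letting [r] tend to 1. *)
Definition mono (r : R) (n m : nat) : C := cint (fun z => ccut r z * (z ^+ n * cconj z ^+ m)).

(** Green's formula for [z^(n-m-1) * (|z|^(2m+2) - r^(2m+2))]: it vanishes on the circle of radius
    [r], and its [d_zbar] is [(m+1) * z^n * zbar^m]. *)
Lemma mono_gt r n m : 0 < r <= 1 -> (m < n)%N -> mono r n m = 0.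
Proof.
move=> r01 mn; pose k := (n - m.+1)%N.
pose e := WMul (wpow WZ k) (WAdd (wpow (WMul WZ WZb) m.+1) (WC (- (Complex (r ^+ 2) 0) ^+ m.+1))).
have e0 z : csq z = r ^+ 2 -> weval e z = 0.
  by move=> h; rewrite /= !weval_pow /= -exprS mul_conj h addrN mulr0.
have := green_dbar r01 e0.
rewrite (_ : cint _ = cint (fun z => m.+1%:R * (ccut r z * (z ^+ n * cconj z ^+ m)))).
  have [e' ee'] : exists e', weval e' = fun z => z ^+ n * cconj z ^+ m.
    by exists (WMul (wpow WZ n) (wpow WZb m)); apply/funext => z /=; rewrite !weval_pow.
  rewrite cintZ; last by have := cdint_ccut_weval r e'; rewrite ee'.
  by move=> /eqP; rewrite mulf_eq0 pnatr_eq0 /= => /eqP.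
apply: cint_ext => p _; rewrite /e /= !wder_pow !weval_pow /=.
have -> : n = (k + m.+1)%N by rewrite subnK.
move: (k) => l; case: m {mn k e e0} => [|m]; rewrite /= ?expr0 ?exprMn !exprD ?exprS -?natr1; ring.
Qed.

(** Green's formula for [zbar * (|z|^(2n) - r^(2n))], whose [d_zbar] is [(n+1) * |z|^(2n) - r^(2n)].
    It takes the place of a computation in polar coordinates and leaves the area [mono r 0 0] as it
    is. *)
Lemma mono_diag r n : 0 < r <= 1 ->
  n.+1%:R * mono r n n = Complex (r ^+ 2) 0 ^+ n * mono r 0 0.
Proof.
move=> r01.
pose e := WMul WZb (WAdd (wpow (WMul WZ WZb) n) (WC (- (Complex (r ^+ 2) 0) ^+ n))).
have e0 z : csq z = r ^+ 2 -> weval e z = 0.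
  by move=> h; rewrite /= !weval_pow /= mul_conj h addrN mulr0.
have cd k l : cdint (fun z => ccut r z * (z ^+ k * cconj z ^+ l)).
  have := cdint_ccut_weval r (WMul (wpow WZ k) (wpow WZb l)).
  by congr cdint; apply/funext => z /=; rewrite !weval_pow.
have := green_dbar r01 e0.
rewrite (_ : cint _ = cint (fun z => n.+1%:R * (ccut r z * (z ^+ n * cconj z ^+ n)) +
   (- (Complex (r ^+ 2) 0 ^+ n) * (ccut r z * (z ^+ 0 * cconj z ^+ 0))))).
  rewrite cintD; [|exact/cdintZ/cd|exact/cdintZ/cd].
  rewrite !cintZ; [|exact/cd|exact/cd].
  by rewrite mulNr => /eqP; rewrite subr_eq0 => /eqP.
apply: cint_ext => p _; rewrite /e /= !wder_pow !weval_pow /= -natr1.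
case: n {e e0} => [|n] /=; rewrite ?expr0 ?exprMn ?exprS; ring.
Qed.

Lemma mono_orth r n m : 0 < r <= 1 -> n != m -> mono r n m = 0.
Proof.
move=> r01; rewrite neq_ltn => /orP[nm|mn]; last exact: mono_gt.
rewrite -[LHS]cconjK -[RHS]cconj0; congr cconj; rewrite /mono -cint_conj.
  rewrite -[RHS](mono_gt r01 nm); apply: cint_ext => p _.
  by rewrite !cconjM ccut_conj !cconjX cconjK [cconj _ ^+ _ * _]mulrC.
have := cdint_ccut_weval r (WMul (wpow WZ n) (wpow WZb m)).
by congr cdint; apply/funext => z /=; rewrite !weval_pow.
Qed.

End Monomials.

(** * Limit theorems and orthonormal series *)

Section Convergence.
Variable R : realType.
Local Notation C := R[i].
Local Notation Re := (@complex.Re R).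
Local Notation Im := (@complex.Im R).
Local Notation leb := (@lebesgue_measure R).
Local Notation mu := (leb \x leb)%E.
Local Notation disc := (@disc R).
Local Notation RR := (measurableTypeR R * measurableTypeR R)%type.

Definition ccvg (u : nat -> C) (l : C) :=
  (fun N => Re (u N)) @ \oo --> Re l /\ (fun N => Im (u N)) @ \oo --> Im l.

Lemma ge0_cvg0_le (x : R) (b : nat -> R) N0 : 0 <= x -> b @ \oo --> 0 ->
  (forall N, (N0 <= N)%N -> x <= b N) -> x = 0.
Proof.
move=> x0 b0 xb; apply/eqP; rewrite eq_le x0 andbT.
by apply: (ler_cvg_to (cvg_cst x) b0); exists N0.
Qed.

Lemma cvg0_le (a b : nat -> R) : b @ \oo --> 0 -> (forall N, 0 <= a N <= b N) -> a @ \oo --> 0.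
Proof.
move=> b0 ab; apply: (@squeeze_cvgr _ _ _ _ (fun=> 0) b) => //; last exact: cvg_cst.
by near=> n; exact: ab.
Unshelve. all: by end_near.
Qed.

Lemma cvg0_sqrt (b : nat -> R) : b @ \oo --> 0 -> (fun N => Num.sqrt (b N)) @ \oo --> 0.
Proof.
move=> b0; rewrite -[X in _ --> X](@sqrtr0 R).
by apply: continuous_cvg b0; exact: sqrt_continuous.
Qed.

Lemma ccvg_csq (u : nat -> C) l (b : nat -> R) : b @ \oo --> 0 ->
  (forall N, csq (l - u N) <= b N) -> ccvg u l.
Proof.
move=> /cvg0_sqrt b0 ub.
have sub (f : C -> R) : (forall x y, f (x - y) = f x - f y) -> (forall z, f z ^+ 2 <= csq z) ->
    (fun N => f (u N)) @ \oo --> f l.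
  move=> fB fle; apply/cvgrPdist_le => eps e0.
  move/cvgrPdist_le: b0 => /(_ eps e0); apply: filterS => N.
  rewrite sub0r normrN => h; rewrite -fB; apply: le_trans (le_trans (ler_norm _) h).
  exact/norm_le_sqrt/(le_trans (fle _)).
split; apply: sub.
- by move=> x y; rewrite !ReImE.
- exact: Re_sqr_le.
- by move=> x y; rewrite !ReImE.
- exact: Im_sqr_le.
Qed.

Lemma ccvg_csq0 (u : nat -> C) l : ccvg u l -> (fun N => csq (l - u N)) @ \oo --> 0.
Proof.
move=> [hR hI].
have -> : (fun N => csq (l - u N)) = (fun N => (Re l - Re (u N)) * (Re l - Re (u N)) +
   (Im l - Im (u N)) * (Im l - Im (u N))).
  by apply/funext => N; rewrite /csq !ReImE; ring.
rewrite -[X in _ --> X](_ : (Re l - Re l) * (Re l - Re l) + (Im l - Im l) * (Im l - Im l) = 0); last by ring.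
by apply: cvgD; apply: cvgM; apply: cvgB => //; exact: cvg_cst.
Qed.

Lemma ccvg_csq_cvg (u : nat -> C) l : ccvg u l -> (fun N => csq (u N)) @ \oo --> csq l.
Proof. by move=> [hR hI]; apply: cvgD; rewrite expr2; apply: cvgM. Qed.

Lemma ccvgB (u : nat -> C) l a : ccvg u l -> ccvg (fun N => u N - a) (l - a).
Proof.
move=> [hR hI]; split.
  under eq_fun do rewrite Re_add; rewrite Re_add; apply: cvgD => //; exact: cvg_cst.
under eq_fun do rewrite Im_add; rewrite Im_add; apply: cvgD => //; exact: cvg_cst.
Qed.

Lemma ccvgM (u : nat -> C) l a : ccvg u l -> ccvg (fun N => a * u N) (a * l).
Proof.
move=> [hR hI]; split.
  under eq_fun do rewrite Re_mul; rewrite Re_mul.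
  by apply: cvgB; apply: cvgM => //; exact: cvg_cst.
under eq_fun do rewrite Im_mul; rewrite Im_mul.
by apply: cvgD; apply: cvgM => //; exact: cvg_cst.
Qed.

Lemma ccvg_shift (u : nat -> C) l n : ccvg u l -> ccvg (fun N => u (N + n)%N) l.
Proof. by move=> [hR hI]; split; [move: hR|move: hI]; rewrite -(cvg_shiftn n). Qed.

Lemma cmeas_lim (S : nat -> C -> C) g : (forall N, cmeas (S N)) ->
  (forall p, disc p -> ccvg (fun N => S N (pt p)) (g (pt p))) -> cmeas g.
Proof.
move=> mS Sg; split.
  apply: (measurable_fun_cvg (h := fun N p => Re (S N (pt p)))) => [N|p dp].
    by have [] := mS N.
  by have [] := Sg p dp.
apply: (measurable_fun_cvg (h := fun N p => Im (S N (pt p)))) => [N|p dp].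
  by have [] := mS N.
by have [] := Sg p dp.
Qed.

(** Fatou's lemma for the squared moduli. It serves for partial sums of orthonormal series and again
    for their tails. *)
Lemma fatou_nsq (S : nat -> C -> C) g B : (forall N, L2 (S N)) -> (forall N, nsq (S N) <= B) ->
  (forall p, disc p -> ccvg (fun N => S N (pt p)) (g (pt p))) -> L2 g /\ nsq g <= B.
Proof.
move=> LS SB Sg.
have mg : cmeas g by apply: cmeas_lim Sg => N; exact: L2_meas.
have mS N : measurable_fun (disc : set RR) (EFin \o (fun p : RR => csq (S N (pt p)))).
  by apply/measurable_EFinP; apply: (cmeas_csq (L2_meas (LS N))).
have pi0 := pi_gt0 R.
have := @fatou _ _ _ mu _ (@measurable_disc R) _ mS.
move=> /(_ (fun N p _ => csq_ge0 _)) fat.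
have {}fat : (\int[mu]_(p in disc) (csq (g (pt p)))%:E <= (B * pi)%:E)%E.
  apply: (@le_trans _ _ (\int[mu]_(p in disc) limn_einf ((fun N => EFin \o (fun p => csq (S N (pt p))))^~ p))%E).
    rewrite le_eqVlt; apply/orP; left; apply/eqP; apply: eq_integral => p /set_mem dp.
    apply/esym; have [] // := @cvg_limn_einf_sup _ (fun N => (csq (S N (pt p)))%:E) (csq (g (pt p)))%:E.
    by apply/cvg_EFin; [exact: nearW|exact: ccvg_csq_cvg (Sg p dp)].
  apply: le_trans fat _.
  rewrite limn_einf_lim; apply: lime_le; first exact: is_cvg_einfs.
  apply: nearW => N; apply: ge_ereal_inf; eexists; first by exists N => //=.
  rewrite dintE; last exact: L2_csq.
  by rewrite lee_fin -ler_pdivrMr // -nsqE SB.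
have ig : dint (fun p => csq (g (pt p))).
  apply/integrableP; split; first by apply/measurable_EFinP; exact: cmeas_csq.
  apply: le_lt_trans (ltry (B * pi)); apply: le_trans fat.
  rewrite (_ : (fun x => `|_|%E) = (fun p => (csq (g (pt p)))%:E)) //.
  by apply/funext => p /=; rewrite ger0_norm ?csq_ge0.
split; first by apply/L2P.
by move: fat; rewrite dintE // lee_fin nsqE ler_pdivrMr.
Qed.

Lemma dI_bounded_cvg (h_ : nat -> RR -> R) (h : RR -> R) B :
  (forall k, measurable_fun (disc : set RR) (h_ k)) -> measurable_fun (disc : set RR) h ->
  (forall p, disc p -> (fun k => h_ k p) @ \oo --> h p) ->
  (forall k p, disc p -> `|h_ k p| <= B) -> (fun k => dI (h_ k)) @ \oo --> dI h.
Proof.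
move=> mh_ mh hh hB.
have hfin : dint h.
  apply: (@dint_bounded _ _ B) => // p dp.
  have := hh p dp; move=> /cvg_norm hn.
  by apply: (ler_cvg_to hn (cvg_cst B)); apply: nearW => k; exact: hB.
have mE k : measurable_fun (disc : set RR) (EFin \o h_ k) by exact/measurable_EFinP.
have mE' : measurable_fun (disc : set RR) (EFin \o h) by exact/measurable_EFinP.
have cE : {ae mu, forall p, disc p -> (fun k => (EFin \o h_ k) p) @ \oo --> (EFin \o h) p}.
  by apply: aeW => p dp; apply/cvg_EFin; [exact: nearW|exact: hh].
have bE : {ae mu, forall p, forall k : nat, disc p -> (`|(EFin \o h_ k) p| <= (EFin \o (fun=> B)) p)%E}.
  by apply: aeW => p k dp; rewrite /= lee_fin hB.
have [_ _ H] := dominated_convergence (@measurable_disc R) mE mE' cE (dint_cst B) bE.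
have {}H : (fun k => (\int[mu]_(p in disc) (h_ k p)%:E)%E) @ \oo --> (dI h)%:E.
  by rewrite -dintE //; exact: H.
exact: fine_cvg H.
Qed.

Lemma nsq_bounded_cvg (S : nat -> C -> C) g B : (forall N, cmeas (S N)) ->
  (forall p, disc p -> ccvg (fun N => S N (pt p)) (g (pt p))) ->
  (forall N p, disc p -> csq (S N (pt p)) <= B) -> (fun N => nsq (S N)) @ \oo --> nsq g.
Proof.
move=> mS Sg SB; have mg := cmeas_lim mS Sg.
under eq_fun do rewrite nsqE; rewrite nsqE; apply: cvgM; last exact: cvg_cst.
apply: (@dI_bounded_cvg _ _ B).
- by move=> k; exact: cmeas_csq.
- exact: cmeas_csq.
- by move=> p dp; exact/ccvg_csq_cvg/Sg.
- by move=> k p dp; rewrite ger0_norm ?csq_ge0 ?SB.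
Qed.

Section OrthonormalSeries.
Variable e : nat -> C -> C.
Hypothesis L2e : forall i, L2 (e i).
Hypothesis one : forall i j, inner (e i) (e j) = (i == j)%:R.
Implicit Types (c : nat -> C) (g : C -> C).

Definition psum c N (z : C) := \sum_(i < N) c i * e i z.

Lemma L2_psum c N : L2 (psum c N).
Proof. by apply: (L2_sum (F := fun i z => c i * e i z)) => i _; exact: L2Z. Qed.

Lemma inner_psum c N i : (i < N)%N -> inner (psum c N) (e i) = c i.
Proof.
move=> iN; rewrite (inner_suml (F := fun i z => c i * e i z)) //; last by move=> *; exact: L2Z.
rewrite (bigD1 (Ordinal iN)) //= big1 => [|j /eqP jN].
  by rewrite addr0 innerZl // one eqxx mulr1.
rewrite innerZl // one (_ : (_ == _) = false) ?mulr0 //.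
by apply/eqP => ji; apply: jN; exact: val_inj.
Qed.

Lemma nsq_psumB c N M : (N <= M)%N ->
  nsq (fun z => psum c M z - psum c N z) = nsq (psum c M) - \sum_(i < N) csq (c i).
Proof.
move=> NM.
have E i : (i < N)%N -> inner (psum c M) (e i) = c i.
  by move=> iN; rewrite inner_psum // (leq_trans iN).
have -> : \sum_(i < N) csq (c i) = \sum_(i < N) csq (inner (psum c M) (e i)).
  by apply: eq_bigr => i _; rewrite E.
rewrite -bessel_residual //; last exact: L2_psum.
by apply: nsq_ext => p _; congr (_ - _); apply: eq_bigr => i _; rewrite E.
Qed.

Lemma nsq_psum c N : nsq (psum c N) = \sum_(i < N) csq (c i).
Proof.
apply/eqP; rewrite -subr_eq0 -nsq_psumB // /nsq.
rewrite (@inner_ext _ _ _ (fun=> 0) (fun=> 0)) ?inner0l //;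
  by move=> p _; rewrite subrr.
Qed.

(** The limit is given pointwise, in place of an appeal to completeness of the [L^2] space. For
    fixed [N], Fatou applied to the blocks from [N] to [M + N] bounds the remainder by the tail
    [limn s - s N] of the numerical series, which tends to 0. *)
Lemma series_L2 c g B : (forall N, \sum_(i < N) csq (c i) <= B) ->
  (forall p, disc p -> ccvg (fun N => psum c N (pt p)) (g (pt p))) ->
  [/\ L2 g, nsq g <= B & (fun N => nsq (fun z => g z - psum c N z)) @ \oo --> 0].
Proof.
move=> cB cg.
have [Lg gB] : L2 g /\ nsq g <= B.
  by apply: fatou_nsq cg => N; [exact: L2_psum|rewrite nsq_psum].
split => //; pose s N := \sum_(i < N) csq (c i).
have s_homo : {homo s : n m / (n <= m)%N >-> n <= m}.
  apply/nondecreasing_seqP => n; rewrite /s big_ord_recr /= lerDl; exact: csq_ge0.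
have s_cvg : cvgn s by apply: nondecreasing_is_cvgn => //; exists B => _ [N _ <-]; exact: cB.
apply: (@cvg0_le _ (fun N => limn s - s N)) => [|N].
  by rewrite -[X in _ --> X](subrr (limn s)); apply: cvgB => //; exact: cvg_cst.
rewrite nsq_ge0 /=.
have LSN : L2 (psum c N) by exact: L2_psum.
apply: (proj2 (@fatou_nsq (fun M z => psum c (M + N) z - psum c N z) _ _ _ _ _)).
- by move=> M; apply: L2B => //; exact: L2_psum.
- move=> M; rewrite nsq_psumB ?leq_addl // nsq_psum lerD2r.
  by apply: nondecreasing_cvgn_le.
- by move=> p dp; apply: ccvgB; apply: (ccvg_shift (u := fun M => psum c M (pt p))); exact: cg.
Qed.

Lemma series_coef c g i : L2 g ->
  (fun N => nsq (fun z => g z - psum c N z)) @ \oo --> 0 -> inner g (e i) = c i.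
Proof.
move=> Lg h; apply/eqP; rewrite -subr_eq0; apply/eqP/csq_eq0.
apply: (@ge0_cvg0_le _ _ i.+1 (csq_ge0 _) h) => N iN.
rewrite -(inner_psum c iN) -innerBl //; last exact: L2_psum.
have := cauchy_schwarz (L2B Lg (L2_psum c N)) (L2e i).
by rewrite {2}/nsq one eqxx mulr1.
Qed.

Lemma series_orth c g u : L2 u -> L2 g ->
  (fun N => nsq (fun z => g z - psum c N z)) @ \oo --> 0 ->
  (forall i, inner u (e i) = 0) -> inner u g = 0.
Proof.
move=> Lu Lg h ue; apply: csq_eq0.
have h' : (fun N => nsq u * nsq (fun z => g z - psum c N z)) @ \oo --> 0.
  by rewrite -[X in _ --> X](mulr0 (nsq u)); apply: cvgM => //; exact: cvg_cst.
apply: (@ge0_cvg0_le _ _ 0%N (csq_ge0 _) h') => N _.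
have -> : inner u g = inner u (fun z => g z - psum c N z).
  rewrite innerBr //; last exact: L2_psum.
  rewrite [inner u (psum _ _)](_ : _ = 0) ?subr0 // (innerC _ Lu); last exact: L2_psum.
  rewrite (inner_suml (F := fun i z => c i * e i z)) // => [|i _]; last exact: L2Z.
  rewrite big1 ?cconj0 // => i _; rewrite innerZl // (innerC Lu) // ue cconj0 mulr0 //.
exact: cauchy_schwarz (L2B Lg (L2_psum c N)).
Qed.

End OrthonormalSeries.

End Convergence.

(** * Orthonormal basis of the Bergman space, its kernel and projection *)

Section BergmanBasis.
Variable R : realType.
Local Notation C := R[i].
Local Notation Re := (@complex.Re R).
Local Notation Im := (@complex.Im R).
Local Notation leb := (@lebesgue_measure R).
Local Notation mu := (leb \x leb)%E.
Local Notation disc := (@disc R).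
Local Notation RR := (measurableTypeR R * measurableTypeR R)%type.

(** The normalised area of the disc, whose true value is 1; it is carried through as a positive
    constant. *)
Definition disc_mass : R := nsq (fun=> 1 : C).

Lemma disc_mass_gt0 : 0 < disc_mass.
Proof.
rewrite /disc_mass nsqE divr_gt0 ?pi_gt0 // (@dI_ext _ _ (fun=> 1)); last by move=> p _; rewrite csq1.
have := dintE (dint_cst (1 : R)); rewrite integral_cst; last exact: measurable_disc.
rewrite mul1e -lte_fin => <-.
pose I : set (measurableTypeR R) := `[0, 2^-1]%classic.
have mI : measurable I by exact: measurable_itv.
have sub : I `*` I `<=` disc.
  move=> [x y]; rewrite /Defs.disc /I /= !in_itv /= => -[/andP[x0 x1] /andP[y0 y1]]; nra.
apply: (@lt_le_trans _ _ (mu (I `*` I))); last first.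
  by apply: le_measure => //; rewrite inE; [exact: measurableX|exact: measurable_disc].
rewrite product_measure1E //.
have E : leb I = (2^-1)%:E.
  by rewrite lebesgue_measure_itv /= lte_fin ifT ?sube0 //; lra.
by rewrite [X in (X * _)%E]E [X in (_ * X)%E]E -EFinM lte_fin; lra.
Qed.

(** By [mono_diag] at radius 1, [z ^ n] has squared norm [disc_mass / (n + 1)]; this is the
    normalising factor. *)
Definition ecoef n : C := Complex (Num.sqrt (n.+1%:R / disc_mass)) 0.
Definition ebas n (z : C) : C := ecoef n * z ^+ n.

Lemma ecoef_neq0 n : ecoef n != 0.
Proof.
rewrite /ecoef eq_complex /= eqxx andbT gt_eqF // sqrtr_gt0.
by rewrite divr_gt0 ?disc_mass_gt0 ?ltr0n.
Qed.

Lemma L2_cst (c : C) : L2 (fun=> c).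
Proof. by apply: (@L2_bounded _ _ (csq c)) => //; exact: cmeas_cst. Qed.

Lemma csq_pt_lt1 p : disc p -> csq (pt p) < 1. Proof. by []. Qed.

Lemma cmeas_ebas n : cmeas (ebas n).
Proof. exact/cmeasZ/cmeasX/cmeas_id. Qed.

Lemma L2_ebas n : L2 (ebas n).
Proof.
apply: (@L2_bounded _ _ (csq (ecoef n))); first exact: cmeas_ebas.
move=> p /csq_pt_lt1 dp; rewrite csqM csqX ler_piMr ?csq_ge0 // exprn_ile1 ?csq_ge0 //.
exact: ltW.
Qed.

Lemma inner_ccut_ebas r i j : inner (fun z => ccut r z * ebas i z) (ebas j) =
  ecoef i * ecoef j * mono r i j.
Proof.
rewrite /inner /mono -cintZ; last first.
  have := cdint_ccut_weval r (WMul (wpow (@WZ R) i) (wpow (@WZb R) j)).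
  by congr cdint; apply/funext => z /=; rewrite !weval_pow.
apply: cint_ext => p _; rewrite /ebas cconjM cconjX cconj_real -/(ecoef j); ring.
Qed.

Lemma ccut1 p : disc p -> ccut 1 (pt p) = 1.
Proof. by move=> dp; rewrite /ccut expr1n csq_pt_lt1. Qed.

Lemma mono00 : mono 1 0 0 = Complex disc_mass 0.
Proof.
rewrite /disc_mass -inner_self; last exact: L2_cst.
by rewrite /mono /inner; apply: cint_ext => p dp; rewrite ccut1 // !expr0 cconj1 !mulr1.
Qed.

Lemma inner_ebas i j : inner (ebas i) (ebas j) = (i == j)%:R.
Proof.
have r1 : 0 < (1 : R) <= 1 by rewrite ltr01 lexx.
have -> : inner (ebas i) (ebas j) = ecoef i * ecoef j * mono 1 i j.
  by rewrite -inner_ccut_ebas; apply: inner_ext => p dp //; rewrite ccut1 // mul1r.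
case: eqVneq => [<-|ij]; last by rewrite mono_orth ?mulr0.
have := mono_diag i r1; rewrite expr1n mono00.
have -> : Complex (1 : R) 0 = 1 by [].
rewrite expr1n mul1r => h.
have n0 : (i.+1%:R : C) != 0 by rewrite pnatr_eq0.
have -> : mono 1 i i = (i.+1%:R)^-1 * Complex disc_mass 0 by rewrite -h mulKf.
have m0 := disc_mass_gt0.
have q0 : 0 <= i.+1%:R / disc_mass by rewrite divr_ge0 ?ler0n ?ltW.
have -> : ecoef i * ecoef i = Complex (i.+1%:R / disc_mass) 0.
  by apply: cplx_eq; rewrite !ReImE /= ?mulr0 ?mul0r ?addr0 ?subr0 // -expr2 sqr_sqrtr.
rewrite mulrCA -[RHS](mulVf n0) natr_complex; congr (_ * _).
by apply: cplx_eq; rewrite !ReImE /= ?mulr0 ?mul0r ?addr0 ?subr0 // divfK ?gt_eqF.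
Qed.

Lemma geometric_le (t : R) N : 0 <= t < 1 -> \sum_(i < N) t ^+ i <= (1 - t)^-1.
Proof.
move=> /andP[t0 t1]; rewrite -[leRHS]mul1r ler_pdivlMr ?subr_gt0 //.
suff -> : (\sum_(i < N) t ^+ i) * (1 - t) = 1 - t ^+ N by rewrite lerBlDr lerDl exprn_ge0.
by elim: N => [|N IH]; rewrite ?big_ord0 ?mul0r ?expr0 ?subrr // big_ord_recr /= mulrDl IH exprS; ring.
Qed.

Lemma cabsM (x y : C) : cabs (x * y) = cabs x * cabs y.
Proof. by rewrite /cabs csqM sqrtrM ?csq_ge0. Qed.
Lemma cabs_ge0 (x : C) : 0 <= cabs x. Proof. exact: sqrtr_ge0. Qed.
Lemma cabs_sqr (x : C) : cabs x ^+ 2 = csq x. Proof. by rewrite sqr_sqrtr ?csq_ge0. Qed.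
Lemma cabsX (x : C) n : cabs (x ^+ n) = cabs x ^+ n.
Proof.
elim: n => [|n IH]; last by rewrite !exprS cabsM IH.
by rewrite !expr0 /cabs csq1 sqrtr1.
Qed.
Lemma cabs_sum_le n (F : nat -> C) : cabs (\sum_(i < n) F i) <= \sum_(i < n) cabs (F i).
Proof.
elim: n => [|n IH]; first by rewrite !big_ord0 /cabs csq0 sqrtr0.
by rewrite !big_ord_recr /=; apply: le_trans (sqrt_csqD _ _) _; rewrite lerD2r.
Qed.

Section Coefficients.
Variables (c : nat -> C) (h : C -> C).
Hypothesis Lh : L2 h.
Hypothesis ch : forall p, disc p -> ccvg (fun N => psum ebas c N (pt p)) (h (pt p)).

(** Convergence at the real point [rho] makes consecutive partial sums differ by a null sequence,
    and these differences are the terms of the series. *)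
Lemma terms_bounded (rho : R) : 0 < rho < 1 -> exists A, forall n, cabs (c n * ecoef n) * rho ^+ n <= A.
Proof.
move=> /andP[r0 r1].
have dp : disc (rho, 0) by rewrite /Defs.disc /= expr0n addr0; nra.
have cc := ch dp.
have t0 : (fun N => csq (psum ebas c N.+1 (pt (rho, 0)) - psum ebas c N (pt (rho, 0)))) @ \oo --> 0.
  set l := h _ in cc; pose u N := psum ebas c N (pt (rho, 0)).
  apply: (@cvg0_le _ _ (fun N => 2 * csq (l - u N.+1) + 2 * csq (l - u N))) => [|N].
    have h0 := ccvg_csq0 cc; rewrite -[X in _ --> X](_ : 2 * 0 + 2 * 0 = 0); last by ring.
    apply: cvgD; apply: cvgM => //; try exact: cvg_cst.
    by move: h0; rewrite -(cvg_shiftS _).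
  rewrite csq_ge0 /= -[csq (l - u N.+1)]csqN.
  have -> : u N.+1 - u N = - (l - u N.+1) + (l - u N) by ring.
  exact: csqD_le.
have /cvg_seq_bounded[M [_ HM]] : cvgn (fun N => csq (psum ebas c N.+1 (pt (rho, 0)) - psum ebas c N (pt (rho, 0)))).
  by apply/cvg_ex; exists 0.
exists (Num.sqrt (M + 1)) => n.
have -> : cabs (c n * ecoef n) * rho ^+ n = cabs (c n * ebas n (pt (rho, 0))).
  rewrite /ebas mulrA [RHS]cabsM cabsX; congr (_ * _ ^+ _).
  by rewrite /cabs csq_real sqrtr_sqr ger0_norm // ltW.
apply: ler_wsqrtr; have := HM (M + 1); rewrite ltrDl ltr01 => /(_ isT n I) /=.
by rewrite /psum big_ord_recr /= addrAC subrr add0r ger0_norm ?csq_ge0.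
Qed.

(** Abel's argument: with [rho] halfway between [r] and 1, the terms on the smaller disc are at most
    [A * (r / rho) ^ i]. *)
Lemma psum_bounded r : 0 < r < 1 ->
  exists B, forall N z, csq z < r ^+ 2 -> csq (psum ebas c N z) <= B.
Proof.
move=> /andP[r0 r1]; pose rho := (r + 1) / 2.
have rho0 : 0 < rho by rewrite /rho; lra.
have rr : r < rho by rewrite /rho; lra.
have [|A HA] := @terms_bounded rho; first by rewrite rho0 /rho; lra.
have A0 : 0 <= A by apply: le_trans (HA 0%N); rewrite mulr_ge0 ?cabs_ge0 ?exprn_ge0 // ltW.
exists ((A / (1 - r / rho)) ^+ 2) => N z zr.
have zr' : cabs z < r.
  rewrite -(@ltr_pXn2r _ 2) ?nnegrE ?cabs_ge0 ?ltW // cabs_sqr //.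
have q01 : 0 <= r / rho < 1 by rewrite divr_ge0 ?ltW //= ltr_pdivrMr // mul1r.
rewrite -cabs_sqr ler_pXn2r ?nnegrE ?cabs_ge0 ?divr_ge0 ?subr_ge0 ?(ltW (andP q01).2) //.
apply: le_trans (cabs_sum_le _ (fun i => c i * ebas i z)) _.
apply: le_trans (ler_wpM2l A0 (geometric_le N q01)); rewrite mulr_sumr.
apply: ler_sum => i _; rewrite /ebas mulrA cabsM cabsX.
apply: (@le_trans _ _ (cabs (c i * ecoef i) * r ^+ i)).
  by rewrite ler_wpM2l ?cabs_ge0 // lerXn2r ?nnegrE ?cabs_ge0 // ltW.
have -> : r ^+ i = rho ^+ i * (r / rho) ^+ i by rewrite -exprMn mulrC divfK // gt_eqF.
by rewrite mulrA ler_wpM2r ?HA // exprn_ge0 // (andP q01).1.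
Qed.

Lemma psum_bounded_disc M : exists B, forall p, disc p -> csq (psum ebas c M (pt p)) <= B.
Proof.
exists ((\sum_(i < M) cabs (c i * ecoef i)) ^+ 2) => p dp.
rewrite -cabs_sqr ler_pXn2r ?nnegrE ?cabs_ge0 ?sumr_ge0 // => [|i _]; last exact: cabs_ge0.
apply: le_trans (cabs_sum_le _ (fun i => c i * ebas i (pt p))) _.
apply: ler_sum => i _; rewrite /ebas mulrA cabsM cabsX ler_piMr ?cabs_ge0 //.
rewrite exprn_ile1 ?cabs_ge0 // -(@ler_pXn2r _ 2) ?nnegrE ?cabs_ge0 // cabs_sqr expr1n.
exact/ltW/csq_pt_lt1.
Qed.

Lemma L2_ccut r (f : C -> C) : L2 f -> L2 (fun z => ccut r z * f z).
Proof.
move=> Lf; apply: (@L2_dom _ _ f 1) => //.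
  by apply: cmeasM; [exact: cmeas_ccut|exact: L2_meas].
by move=> p _; rewrite csqM ler_wpM2r ?csq_ge0 ?csq_ccut_le.
Qed.

(** Monomials stay orthogonal after restriction to a concentric disc, so every further term can only
    increase the norm. *)
Lemma nsq_ccut_psum_homo r N M : 0 < r <= 1 -> (M <= N)%N ->
  nsq (fun z => ccut r z * psum ebas c M z) <= nsq (fun z => ccut r z * psum ebas c N z).
Proof.
move=> r01; elim: N => [|N IH]; first by rewrite leqn0 => /eqP ->.
rewrite leq_eqVlt => /predU1P[-> //|]; rewrite ltnS => /IH le1; apply: le_trans le1 _.
pose f i z := c i * (ccut r z * ebas i z).
have Lf i : L2 (f i) by exact/L2Z/L2_ccut/L2_ebas.
pose S z := \sum_(i < N) f i z.
have LS : L2 S by exact: L2_sum.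
rewrite (@nsq_ext _ _ S); last first.
  by move=> p _; rewrite /psum mulr_sumr; apply: eq_bigr => i _; rewrite /f mulrCA.
rewrite [leRHS](@nsq_ext _ _ (fun z => S z - (-1) * f N z)); last first.
  move=> p _; rewrite /psum mulr_sumr big_ord_recr /= mulN1r opprK mulrCA; congr (_ + _).
  by apply: eq_bigr => i _; rewrite /f mulrCA.
rewrite nsqB //; last exact: L2Z.
rewrite innerZr // [inner S _](_ : _ = 0) ?mulr0 ?subr0 ?lerDl ?nsq_ge0 //.
rewrite inner_suml // big1 // => i _; rewrite innerZl //; last exact/L2_ccut/L2_ebas.
rewrite innerZr; [|exact/L2_ccut/L2_ebas|exact/L2_ccut/L2_ebas].
rewrite (_ : inner _ _ = inner (fun z => ccut r z * ebas i z) (ebas N)).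
  by rewrite inner_ccut_ebas mono_orth ?mulr0 // neq_ltn ltn_ord.
apply: cint_ext => p _; rewrite cconjM ccut_conj -[in RHS](ccut_sq r); ring.
Qed.

(** On the disc of radius [r < 1] the partial sums converge boundedly to [h], so their norms
    increase to that of [ccut r * h], and restricting [h] does not increase its norm. *)
Lemma nsq_ccut_psum_le r M : 0 < r < 1 -> nsq (fun z => ccut r z * psum ebas c M z) <= nsq h.
Proof.
move=> /andP[r0 r1]; have r01 : 0 < r <= 1 by rewrite r0 ltW.
have mS N : cmeas (fun z => ccut r z * psum ebas c N z).
  by apply: cmeasM; [exact: cmeas_ccut|exact/L2_meas/L2_psum/L2_ebas].
apply: (@le_trans _ _ (nsq (fun z => ccut r z * h z))); last first.
  rewrite -[leRHS]mul1r; apply: nsq_dom => //; first exact/L2_meas/L2_ccut.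
  by move=> p _; rewrite csqM ler_wpM2r ?csq_ge0 ?csq_ccut_le.
have [|B hB] := @psum_bounded r; first by rewrite r0.
have B0 : 0 <= B.
  by apply: le_trans (hB 0%N 0 _); rewrite ?csq_ge0 ?csq0 ?exprn_gt0.
have lim : (fun N => nsq (fun z => ccut r z * psum ebas c N z)) @ \oo --> nsq (fun z => ccut r z * h z).
  apply: (@nsq_bounded_cvg _ _ _ B) => // [p dp|N p dp]; first exact/ccvgM/ch.
  by rewrite csqM /ccut; case: ifP => hp; rewrite ?csq0 ?mul0r // csq1 mul1r hB.
by apply: (ler_cvg_to (cvg_cst _) lim); exists M => // N /= MN; exact: nsq_ccut_psum_homo.
Qed.

(** At this stage the [c i] are power series coefficients and not yet inner products of [h] with
    [ebas i], so Bessel's inequality cannot be quoted. The bound holds on every smaller disc and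
    survives as the radius tends to 1, [M] being fixed. *)
Lemma coef_bessel M : \sum_(i < M) csq (c i) <= nsq h.
Proof.
rewrite -(nsq_psum L2_ebas inner_ebas).
(* The factor [2^-1] keeps the radius strictly positive at [k = 0], where [harmonic] equals 1. *)
pose r (k : nat) : R := 1 - 2^-1 * harmonic k.
have hk k : 0 < (harmonic k : R) <= 1.
  by rewrite /harmonic invr_gt0 ltr0n /= invf_le1 ?ltr0n // ler1n.
have rk k : 0 < r k < 1 by have := hk k; rewrite /r => /andP[? ?]; apply/andP; split; lra.
have r1 : (fun k => r k ^+ 2) @ \oo --> (1 : R).
  have rc : r @ \oo --> (1 : R).
    rewrite -[X in _ --> X](_ : 1 - 2^-1 * 0 = 1); last by rewrite mulr0 subr0.
    by apply: cvgB; [exact: cvg_cst|apply: cvgM; [exact: cvg_cst|exact: cvg_harmonic]].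
  by rewrite -[X in _ --> X](mulr1 1); under eq_fun do rewrite expr2; exact: cvgM.
have [B hB] := psum_bounded_disc M.
have B0 : 0 <= B.
  apply: le_trans (hB (0, 0) _); first exact: csq_ge0.
  by rewrite /Defs.disc /= expr0n addr0.
have mS : cmeas (psum ebas c M) by exact/L2_meas/L2_psum/L2_ebas.
have lim : (fun k => nsq (fun z => ccut (r k) z * psum ebas c M z)) @ \oo --> nsq (psum ebas c M).
  apply: (@nsq_bounded_cvg _ _ _ B) => [k|p dp|k p dp].
  - by apply: cmeasM => //; exact: cmeas_ccut.
  - have nr : \forall k \near \oo, ccut (r k) (pt p) * psum ebas c M (pt p) = psum ebas c M (pt p).
      have nr0 : \forall k \near \oo, csq (pt p) < r k ^+ 2.
        by apply: (cvgr_gt 1 r1); exact: csq_pt_lt1.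
      by apply: filterS nr0 => k hk'; rewrite /ccut hk' mul1r.
    by split; apply: (cvg_near_cst); apply: filterS nr => k ->.
  - by rewrite csqM -[B]mul1r ler_pM ?csq_ge0 ?csq_ccut_le ?hB.
by apply: (ler_cvg_to lim (cvg_cst _)); apply: nearW => k; exact: nsq_ccut_psum_le.
Qed.

End Coefficients.

(** Completeness of [ebas]; [proj_is_proj] uses it to test orthogonality against an arbitrary
    Bergman function. *)
Lemma bergman_series f : bergman f -> exists c,
  (fun N => nsq (fun z => f z - psum ebas c N z)) @ \oo --> 0.
Proof.
move=> [[a fa] Lf]; exists (fun n => a n / ecoef n).
have ch p : disc p -> ccvg (fun N => psum ebas (fun n => a n / ecoef n) N (pt p)) (f (pt p)).
  have E N : psum ebas (fun n => a n / ecoef n) N (pt p) = \sum_(n < N) a n * pt p ^+ n.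
    by apply: eq_bigr => i _; rewrite /ebas mulrA divfK //; exact: ecoef_neq0.
  by move=> /fa[h1 h2]; split; under eq_fun do rewrite E.
by have [] := series_L2 L2_ebas inner_ebas (coef_bessel Lf ch) ch.
Qed.

(** As a function of [w] this is the sum of [cconj (ebas n z) * ebas n w], analytic in [w]; [inner]
    conjugates it in [proj]. The constant comes from [ecoef n ^ 2 = (n + 1) / disc_mass]. *)
Definition kernel (z w : C) : C := Complex (disc_mass^-1) 0 / (1 - cconj z * w) ^+ 2.
Definition proj (u : C -> C) (z : C) : C := inner u (kernel z).

Lemma csqV (x : C) : csq x^-1 = (csq x)^-1.
Proof.
have [->|x0] := eqVneq x 0; first by rewrite invr0 csq0 invr0.
apply: (mulfI (x := csq x)); last by rewrite -csqM divff // csq1 divff //; apply: contra x0 => /eqP/csq_eq0 ->.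
by apply: contra x0 => /eqP/csq_eq0 ->.
Qed.

Lemma cabs_pt_lt1 p : disc p -> cabs (pt p) < 1.
Proof. by move=> dp; rewrite -(@ltr_pXn2r _ 2) ?nnegrE ?cabs_ge0 // cabs_sqr expr1n csq_pt_lt1. Qed.

Lemma csq_1B_ge (x : C) s : cabs x <= s -> s < 1 -> (1 - s) ^+ 2 <= csq (1 - x).
Proof.
move=> xs s1; have := sqrt_csqD (1 - x) x.
rewrite subrK csq1 sqrtr1 -/(cabs x) -/(cabs (1 - x)) => h.
rewrite -cabs_sqr lerXn2r ?nnegrE ?cabs_ge0 ?subr_ge0 //; first exact: ltW.
by lra.
Qed.

(** Each of the [N + 1] powers [t ^ i] with [i <= N] is at least [t ^ N]. This pays for the linear
    factor in the remainder of the kernel series. *)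
Lemma lin_geometric_le (t : R) N : 0 <= t < 1 -> N.+1%:R * t ^+ N <= (1 - t)^-1.
Proof.
move=> t01; apply: le_trans (geometric_le N.+1 t01).
have /andP[t0 t1] := t01.
rewrite mulr_natl -[N.+1 in leLHS]card_ord -sumr_const; apply: ler_sum => i _.
by apply: ler_wiXn2l => //; [exact: ltW|rewrite -ltnS].
Qed.

(** With [x = cconj z * w], the remainder of the series of [1 / (1 - x) ^ 2] is
    [((N+1) - N x) * x^N / (1 - x)^2], and [|x| <= s = |z|]. The decay [s^(2N)] is split as
    [s^N * t^(2N)] with [t ^ 2 = s]: the second factor absorbs [(N+1)^2], the first tends to 0,
    uniformly in [w]. *)
Lemma kernel_sum_bound z : cabs z < 1 -> exists2 b : nat -> R, b @ \oo --> 0 &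
  forall N p, disc p -> csq (kernel z (pt p) - \sum_(n < N) cconj (ebas n z) * ebas n (pt p)) <= b N.
Proof.
move=> z1; set s := cabs z in z1; have s0 : 0 <= s by exact: cabs_ge0.
have t01 : 0 <= Num.sqrt s < 1 by rewrite sqrtr_ge0 /= -sqrtr1 ltr_sqrt.
set t := Num.sqrt s in t01; have ts : t ^+ 2 = s by rewrite sqr_sqrtr.
pose A := (disc_mass^-1) ^+ 2 * 4 * ((1 - t)^-1) ^+ 2 / (1 - s) ^+ 2 ^+ 2.
exists (fun N => A * s ^+ N).
  rewrite -[X in _ --> X](mulr0 A); apply: cvgM; first exact: cvg_cst.
  by apply: cvg_expr; rewrite ger0_norm.
move=> N p dp; pose x := cconj z * pt p; set w := pt p in x *.
have xs : cabs x <= s.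
  rewrite cabsM {1}/cabs csqC -/(cabs z) -/s ler_piMr //; exact/ltW/cabs_pt_lt1.
have D0 := csq_1B_ge xs z1.
have s10 : 0 < (1 - s) ^+ 2 by rewrite exprn_gt0 // subr_gt0.
have y0 : 1 - x != 0.
  by apply/eqP => e; move: D0; rewrite e csq0 leNgt s10.
have m0 := disc_mass_gt0.
have sumE : \sum_(n < N) cconj (ebas n z) * ebas n w =
    Complex (disc_mass^-1) 0 * \sum_(n < N) n.+1%:R * x ^+ n.
  rewrite mulr_sumr; apply: eq_bigr => n _.
  rewrite /ebas cconjM cconjX cconj_real mulrACA -exprMn -/x mulrA; congr (_ * _).
  have q0 : 0 <= n.+1%:R / disc_mass by rewrite divr_ge0 ?ler0n ?ltW.
  rewrite natr_complex; apply: cplx_eq; rewrite !ReImE /= ?mulr0 ?mul0r ?addr0 ?subr0 //.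
  by rewrite -expr2 sqr_sqrtr // mulrC.
have geo : (1 - x) ^+ 2 * \sum_(n < N) n.+1%:R * x ^+ n = 1 - (N.+1%:R - N%:R * x) * x ^+ N.
  elim: (N) => [|k IH]; first by rewrite big_ord0 mulr0 mul0r subr0 expr0 mulr1 subrr.
  by rewrite big_ord_recr /= mulrDr IH [x ^+ k.+1]exprS -!natr1; ring.
have -> : kernel z w - \sum_(n < N) cconj (ebas n z) * ebas n w =
    Complex (disc_mass^-1) 0 * ((N.+1%:R - N%:R * x) * x ^+ N / (1 - x) ^+ 2).
  rewrite sumE /kernel -mulrBr; congr (_ * _).
  have n2 : (1 - x) ^+ 2 != 0 by rewrite expf_neq0.
  apply: (mulIf n2); rewrite mulfVK // mulrBl mulVf // mulrC mulrC.
  by rewrite [X in 1 - X]mulrC geo subKr.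
have c1 : csq (N.+1%:R - N%:R * x) <= 4 * (N.+1%:R) ^+ 2.
  apply: le_trans (csqD_le _ _) _; rewrite csqN csqM.
  have nC (k : nat) : csq (k%:R : C) = k%:R ^+ 2.
    by rewrite natr_complex csq_real.
  rewrite !nC -natr1; have x1 : csq x <= 1.
    by rewrite -cabs_sqr exprn_ile1 ?cabs_ge0 // (le_trans xs) // ltW.
  have N0 : 0 <= (N%:R : R) by exact: ler0n.
  have := csq_ge0 x; nra.
rewrite !csqM csqV !csqX csq_real.
have xN : csq x ^+ N <= s ^+ N * t ^+ N ^+ 2.
  rewrite -exprM mulnC exprM ts -exprMn lerXn2r ?nnegrE ?csq_ge0 ?mulr_ge0 //.
  by rewrite -cabs_sqr -expr2 ler_pXn2r ?nnegrE ?cabs_ge0.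
have tN := lin_geometric_le N t01.
have /andP[t0 t1] := t01.
pose Y := (1 - s) ^+ 2 ^+ 2; have Y0 : 0 < Y by rewrite exprn_gt0.
have q2 : (N.+1%:R * t ^+ N) ^+ 2 <= (1 - t)^-1 ^+ 2.
  by rewrite lerXn2r ?nnegrE ?invr_ge0 ?subr_ge0 ?mulr_ge0 ?ler0n ?exprn_ge0 //; exact: ltW.
have c2 : csq (N.+1%:R - N%:R * x) * (csq x ^+ N / csq (1 - x) ^+ 2) <=
    4 * N.+1%:R ^+ 2 * ((s ^+ N * t ^+ N ^+ 2) / Y).
  apply: ler_pM => //; first exact: csq_ge0.
    by apply: divr_ge0; apply: exprn_ge0; exact: csq_ge0.
  apply: ler_pM => //.
  - by apply: exprn_ge0; exact: csq_ge0.
  - by rewrite invr_ge0; apply: exprn_ge0; exact: csq_ge0.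
  - have h0 : 0 < csq (1 - x) by exact: lt_le_trans D0.
    have le2 : Y <= csq (1 - x) ^+ 2 by rewrite lerXn2r ?nnegrE ?csq_ge0 //; exact: ltW.
    by rewrite lef_pV2 // posrE exprn_gt0.
apply: (@le_trans _ _ (disc_mass^-1 ^+ 2 * (4 * (N.+1%:R ^+ 2 * (s ^+ N * t ^+ N ^+ 2 / Y))))).
  by rewrite ler_wpM2l ?sqr_ge0 // [leRHS]mulrA -[leLHS]mulrA.
have -> : A * s ^+ N = (disc_mass^-1 ^+ 2 * 4 / Y * s ^+ N) * (1 - t)^-1 ^+ 2.
  by rewrite /A -/Y; move: (Y^-1) => Yi; ring.
have -> : disc_mass^-1 ^+ 2 * (4 * (N.+1%:R ^+ 2 * (s ^+ N * t ^+ N ^+ 2 / Y))) =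
    (disc_mass^-1 ^+ 2 * 4 / Y * s ^+ N) * (N.+1%:R * t ^+ N) ^+ 2.
  by move: (Y^-1) => Yi; rewrite exprMn; move: (N.+1%:R) (t ^+ N) (s ^+ N) => *; ring.
apply: ler_wpM2l => //; apply: mulr_ge0; last exact: exprn_ge0.
apply: mulr_ge0; last by rewrite invr_ge0 ltW.
by apply: mulr_ge0 => //; exact: sqr_ge0.
Qed.

Lemma cmeas_kernel z : cabs z < 1 -> cmeas (kernel z).
Proof.
move=> /kernel_sum_bound[b b0 hb].
apply: (@cmeas_lim _ (fun N w => \sum_(n < N) cconj (ebas n z) * ebas n w)) => [N|p dp].
  by apply/L2_meas/(L2_sum (F := fun n w => cconj (ebas n z) * ebas n w)) => i _; exact/L2Z/L2_ebas.
by apply: ccvg_csq b0 _ => N; exact: hb.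
Qed.

Lemma L2_kernel z : cabs z < 1 -> L2 (kernel z).
Proof.
move=> z1; have [b b0 hb] := kernel_sum_bound z1.
apply: (@L2_bounded _ _ (b 0%N)); first exact: cmeas_kernel.
by move=> p dp; have := hb 0%N p dp; rewrite big_ord0 subr0.
Qed.

Lemma proj_series u p : L2 u -> disc p ->
  ccvg (fun N => psum ebas (fun n => inner u (ebas n)) N (pt p)) (proj u (pt p)).
Proof.
move=> Lu dp; have z1 := cabs_pt_lt1 dp; have [b b0 hb] := kernel_sum_bound z1.
(* Cauchy--Schwarz against the kernel remainder: its uniform bound [b N] is integrated over the
   disc, hence the factor [disc_mass]. *)
have b0' : (fun N => nsq u * (b N * disc_mass)) @ \oo --> 0.
  rewrite -[X in _ --> X](_ : nsq u * (0 * disc_mass) = 0); last by ring.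
  apply: cvgM; first exact: cvg_cst.
  by apply: cvgM => //; exact: cvg_cst.
apply: ccvg_csq b0' _ => N; set z := pt p in z1 hb *.
pose F n w := cconj (ebas n z) * ebas n w.
have LF n : L2 (F n) by exact/L2Z/L2_ebas.
have LS : L2 (fun w => \sum_(n < N) F n w) by exact: L2_sum.
have -> : psum ebas (fun n => inner u (ebas n)) N z = inner u (fun w => \sum_(n < N) F n w).
  rewrite (innerC LS Lu) inner_suml // cconj_sum; apply: eq_bigr => i _.
  rewrite -(innerC (LF i) Lu) /F innerZr //; last exact: L2_ebas.
  by rewrite cconjK mulrC.
have LK := L2_kernel z1.
rewrite /proj -innerBr //; apply: le_trans (cauchy_schwarz Lu (L2B LK LS)) _.
rewrite ler_wpM2l ?nsq_ge0 //; apply: nsq_dom.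
- by apply: le_trans (hb N p dp); exact: csq_ge0.
- exact/L2_meas/L2B.
- exact: L2_cst.
- by move=> q dq; rewrite csq1 mulr1; exact: hb.
Qed.

Lemma proj_L2 u : L2 u -> [/\ L2 (proj u), nsq (proj u) <= nsq u
  & (fun N => nsq (fun z => proj u z - psum ebas (fun n => inner u (ebas n)) N z)) @ \oo --> 0].
Proof.
move=> Lu; apply: (series_L2 L2_ebas inner_ebas) => [N|p dp]; last exact: proj_series.
by apply: bessel_le => // *; [exact: L2_ebas|exact: inner_ebas].
Qed.

(** The expansion of [proj u] along [ebas] is itself a power series, and has the same coefficients
    as [u]. Hence [u - proj u] is orthogonal to every [ebas i], and by completeness to the Bergman
    space. *)
Lemma proj_is_proj u : L2 u -> is_bergman_proj u (proj u).
Proof.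
move=> Lu; have [LP _ lim] := proj_L2 Lu; split; first split => //.
  exists (fun n => inner u (ebas n) * ecoef n) => p dp.
  have E N : \sum_(n < N) inner u (ebas n) * ecoef n * pt p ^+ n =
      psum ebas (fun n => inner u (ebas n)) N (pt p).
    by apply: eq_bigr => i _; rewrite /ebas mulrA.
  by have [h1 h2] := proj_series Lu dp; split; under eq_fun do rewrite E.
move=> f bf; have [c hc] := bergman_series bf; have [_ Lf] := bf.
apply: (series_orth L2_ebas (L2B Lu LP) Lf hc) => i.
rewrite innerBl //; last exact: L2_ebas.
by rewrite (series_coef L2_ebas inner_ebas i LP lim) subrr.
Qed.

End BergmanBasis.

(** * Integrals that grow like a power of [ln (1 / eps)] *)

Section LogarithmicIntegral.
Variable R : realType.
Local Notation leb := (@lebesgue_measure R).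
Local Notation mu := (leb \x leb)%E.
Local Notation disc := (@disc R).
Local Notation RR := (measurableTypeR R * measurableTypeR R)%type.
Variable eps : R.
Hypothesis eps0 : 0 < eps.

(** The sign [s] treats both sides of [q] at once: where [s * (x - q) >= 0] it equals [|x - q|], and
    [s * ln (s * (x - q) + eps)] is an antiderivative because [s ^ 2 = 1]. *)
Lemma int_inv_shift (s q a b : R) : s ^+ 2 = 1 -> a < b ->
  (forall x, a <= x <= b -> 0 <= s * (x - q)) ->
  (\int[leb]_(x in `[a, b]) ((s * (x - q) + eps)^-1)%:E =
     (s * (ln (s * (b - q) + eps) - ln (s * (a - q) + eps)))%:E)%E.
Proof.
move=> s2 ab pos.
have posx x : a <= x <= b -> 0 < s * (x - q) + eps by move=> /pos h; exact: ltr_wpDl.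
have dF x : a <= x <= b -> is_derive x (1 : R) (fun x => s * ln (s * (x - q) + eps)) ((s * (x - q) + eps)^-1).
  move=> /posx x0.
  have d1 : is_derive x (1 : R) (fun x => s * (x - q) + eps) s.
    have d := has_derD (has_derM (@has_der_cst R s) (has_derB (@has_der_id R) (@has_der_cst R q))) (@has_der_cst R eps).
    by apply: (is_derive_eq (d x)); rewrite /=; ring.
  have d2 := @is_derive1_comp R (@ln R) (fun x => s * (x - q) + eps) x _ _ (is_derive1_ln x0) d1.
  apply: (is_derive_eq (is_deriveZ s d2)).
  by rewrite /GRing.scale /= mulrCA -expr2 s2 mulr1.
have dcont x : a <= x <= b -> {for x, continuous (fun x => s * ln (s * (x - q) + eps))}.
  by move=> /dF [d _]; exact/differentiable_continuous/derivable1_diffP.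
rewrite (@continuous_FTC2 _ _ (fun x => s * ln (s * (x - q) + eps))) //.
- by rewrite [X in _ = X%:E]mulrBr.
- apply: continuous_in_subspaceT => x; rewrite inE /= in_itv /= => xab.
  apply: cvgV; first by rewrite gt_eqF // posx.
  apply: cvgD; last exact: cvg_cst.
  by apply: cvgM; [exact: cvg_cst|apply: cvgB; [exact: cvg_id|exact: cvg_cst]].
- split.
  + move=> x; rewrite in_itv /= => /andP[x1 x2].
    by have [] := dF x _; rewrite ?(ltW x1) ?(ltW x2).
  + by apply/cvg_at_right_filter/dcont; rewrite lexx ltW.
  + by apply/cvg_at_left_filter/dcont; rewrite lexx ltW.
- move=> x; rewrite in_itv /= => /andP[x1 x2]; rewrite derive1E.
  by have [] := dF x _; rewrite ?(ltW x1) ?(ltW x2).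
Qed.

(** A regularised [1 / |x - q|]. Being zero off [[-1, 1]], it lets an integral over the disc be
    enlarged to the plane, where products of spikes separate. *)
Definition spike (q x : R) : R := if -1 <= x <= 1 then (`|x - q| + eps)^-1 else 0.

Lemma spike_den_gt0 (q x : R) : 0 < `|x - q| + eps. Proof. by rewrite ltr_wpDl. Qed.

Lemma spike_ge0 q x : 0 <= spike q x.
Proof. by rewrite /spike; case: ifP => // _; rewrite invr_ge0 ltW ?spike_den_gt0. Qed.

Lemma measurable_inv_dist (q : R) : measurable_fun setT (fun x : R => (`|x - q| + eps)^-1).
Proof.
apply: continuous_measurable_fun => x.
apply: cvgV; first by rewrite gt_eqF // spike_den_gt0.
apply: cvgD; last exact: cvg_cst.
by apply: cvg_norm; apply: cvgB; [exact: cvg_id|exact: cvg_cst].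
Qed.

Lemma measurable_spike q : measurable_fun setT (spike q).
Proof.
have -> : spike q = (fun x => (`|x - q| + eps)^-1) \_ `[-1, 1].
  by apply/funext => x; rewrite patchE /spike mem_setE in_itv.
by apply/(measurable_restrictT _ _).1 => //; exact: measurable_funS (measurable_inv_dist q).
Qed.

(** The integral of [1 / (|x - q| + eps)] over [[q - 2, q + 2]]. This interval contains [[-1, 1]]
    whenever [|q| <= 1], so the bound does not depend on [q]. *)
Definition logint := 2 * ln ((2 + eps) / eps).

Lemma spike_int q : -1 <= q <= 1 -> (\int[leb]_x (spike q x)%:E <= logint%:E)%E.
Proof.
move=> /andP[q1 q2].
pose g (x : R) : \bar R := ((`|x - q| + eps)^-1)%:E.
pose D1 := `[q, q + 2]%classic : set R.
pose D2 := `[q - 2, q]%classic : set R.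
have mg (D : set R) : measurable D -> measurable_fun setT (g \_ D).
  move=> mD; apply/(measurable_restrictT _ _).1 => //.
  by apply/measurable_EFinP; exact: measurable_funS (measurable_inv_dist q).
have g0 x : (0 <= g x)%E by rewrite lee_fin invr_ge0 ltW ?spike_den_gt0.
have gD0 D x : (0 <= (g \_ D) x)%E by rewrite patchE; case: ifP.
have mD1 : measurable D1 by exact: measurable_itv.
have mD2 : measurable D2 by exact: measurable_itv.
apply: (@le_trans _ _ (\int[leb]_x ((g \_ D1) x + (g \_ D2) x))%E).
  apply: ge0_le_integral => //.
  - by move=> x _; rewrite lee_fin spike_ge0.
  - by apply/measurable_EFinP; exact: measurable_spike.
  - by apply: emeasurable_funD; exact: mg.
  - move=> x _; rewrite /spike; case: ifP => [/andP[x1 x2]|_]; last exact: adde_ge0.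
    have [qx|xq] := leP q x.
      rewrite [(g \_ D1) x]patchE (_ : x \in D1) ?leeDl //.
      by rewrite mem_setE in_itv /= qx; lra.
    rewrite [(g \_ D2) x]patchE (_ : x \in D2) ?leeDr //.
    by rewrite mem_setE in_itv /= (ltW xq) andbT; lra.
rewrite ge0_integralD //; [|exact: mg|exact: mg].
rewrite -!integral_mkcond.
have -> : (\int[leb]_(x in D1) g x = \int[leb]_(x in `[q, (q + 2)%R]) ((1 * (x - q) + eps)^-1)%:E)%E.
  apply: eq_integral => x; rewrite mem_setE in_itv /= => /andP[x1 _].
  by rewrite /g ger0_norm ?subr_ge0 // mul1r.
have -> : (\int[leb]_(x in D2) g x = \int[leb]_(x in `[(q - 2)%R, q]) (((-1) * (x - q) + eps)^-1)%:E)%E.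
  apply: eq_integral => x; rewrite mem_setE in_itv /= => /andP[_ x1].
  by rewrite /g ler0_norm ?subr_le0 // mulN1r.
rewrite !int_inv_shift //.
- have e2 : 0 < 2 + eps by have := eps0; lra.
  rewrite -EFinD lee_fin /logint lnM ?posrE ?invr_gt0 //.
  rewrite lnV ?posrE // subrr mulr0 add0r.
  rewrite (_ : 1 * (q + 2 - q) + eps = 2 + eps); last by ring.
  rewrite (_ : -1 * (q - 2 - q) + eps = 2 + eps); last by ring.
  by rewrite mulr0 add0r; lra.
- by rewrite sqrrN expr1n.
- by lra.
- by move=> x /andP[_ ?]; lra.
- by rewrite expr1n.
- by lra.
- by move=> x /andP[? _]; lra.
Qed.

Lemma spike2_int (a b : R) : -1 <= a <= 1 -> -1 <= b <= 1 ->
  dint (fun p : RR => spike a p.1 * spike b p.2) /\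
  dI (fun p : RR => spike a p.1 * spike b p.2) <= logint ^+ 2.
Proof.
move=> ha hb.
have mf : measurable_fun (setT : set RR) (fun p : RR => spike a p.1 * spike b p.2).
  apply: measurable_funM; apply: measurableT_comp => //; exact: measurable_spike.
have f0 (p : RR) : (0 <= (spike a p.1 * spike b p.2)%:E)%E by rewrite lee_fin mulr_ge0 ?spike_ge0.
have J0 q : (0 <= \int[leb]_x (spike q x)%:E)%E.
  by apply: integral_ge0 => x _; rewrite lee_fin spike_ge0.
have L0 : 0 <= logint.
  by rewrite -lee_fin; apply: le_trans (J0 a) (spike_int ha).
have bound : (\int[mu]_(p in disc) (spike a p.1 * spike b p.2)%:E <= (logint ^+ 2)%:E)%E.
  apply: (@le_trans _ _ (\int[mu]_p (spike a p.1 * spike b p.2)%:E)%E).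
    apply: ge0_subset_integral => //; first exact: measurable_disc.
    exact/measurable_EFinP.
  rewrite fubini_tonelli1 //=; last exact/measurable_EFinP.
  rewrite /fubini_F /=.
  have E x : (\int[leb]_y (spike a x * spike b y)%:E = (spike a x)%:E * \int[leb]_y (spike b y)%:E)%E.
    under eq_integral do rewrite EFinM.
    rewrite ge0_integralZl_EFin //; last exact: spike_ge0.
    - by move=> y _; rewrite lee_fin spike_ge0.
    - by apply/measurable_EFinP; exact: measurable_spike.
  under eq_integral do rewrite E.
  rewrite ge0_integralZr //.
  - by rewrite expr2 EFinM; apply: lee_pmul; rewrite ?J0 ?spike_int.
  - by apply/measurable_EFinP; exact: measurable_spike.
  - by move=> x _; rewrite lee_fin spike_ge0.
have di : dint (fun p : RR => spike a p.1 * spike b p.2).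
  apply/integrableP; split; first by apply/measurable_EFinP; exact: measurable_funS mf.
  apply: le_lt_trans (ltry (logint ^+ 2)); apply: le_trans bound.
  rewrite (_ : (fun x => `|_|%E) = (fun p : RR => (spike a p.1 * spike b p.2)%:E)) //.
  by apply/funext => p /=; rewrite ger0_norm // -lee_fin.
by split => //; move: bound; rewrite dintE // lee_fin.
Qed.

End LogarithmicIntegral.

(** * Domination of the kernel across a separating line *)

Section KernelBound.
Variable R : realType.
Local Notation C := R[i].
Local Notation disc := (@disc R).
Local Notation RR := (measurableTypeR R * measurableTypeR R)%type.
Variable eps : R.
Hypothesis eps0 : 0 < eps.
Variables (a b : R).
Hypothesis ab1 : a ^+ 2 + b ^+ 2 = 1.

Lemma le_sum_norm (u v m : R) : 0 <= m -> u ^+ 2 + v ^+ 2 = m ^+ 2 -> m <= `|u| + `|v|.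
Proof.
move=> m0 uv; rewrite -(@ler_pXn2r _ 2) ?nnegrE ?addr_ge0 // -uv.
rewrite -[u ^+ 2]real_normK ?num_real // -[v ^+ 2]real_normK ?num_real // sqrrD.
by rewrite lerD2r lerDl mulrn_wge0 // mulr_ge0.
Qed.

(* The separating line meets the unit circle at +-(b, -a). *)
Definition omega (p : RR) : R := spike eps (- b) p.1 * spike eps a p.2 +
  spike eps b p.1 * spike eps (- a) p.2.

(** In coordinates [s] across the line and [t] along it, [|s| <= D] and [1 - |p| <= D] force
    [1 - |t| <= 2 D]. So [p] is close to the end of the diameter on the side given by the sign of
    [t]: each Cartesian coordinate differs by at most [3 D], hence by at most [4 D] with [eps]
    added. The product of the two spikes at that end is then at least [1 / (16 D^2)]. *)
Lemma omega_lower (p : RR) (D : R) : disc p -> 0 < D -> eps <= D ->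
  `|a * p.1 + b * p.2| <= D -> 1 - cabs (pt p) <= D -> (D ^+ 2)^-1 <= 16 * omega p.
Proof.
case: p => x y /=; move=> dp D0 eD sD zD.
pose s := a * x + b * y; pose t := a * y - b * x.
have st : s ^+ 2 + t ^+ 2 = cabs (pt (x, y)) ^+ 2.
  by rewrite cabs_sqr /csq /= -[RHS]mul1r -ab1 /s /t; ring.
have m0 := cabs_ge0 (pt (x, y)); have m1 := cabs_pt_lt1 dp.
set m := cabs _ in zD st m0 m1.
have tm : m <= `|s| + `|t| by exact: le_sum_norm.
have t1 : `|t| <= 1.
  rewrite -(@ler_pXn2r _ 2) ?nnegrE // real_normK ?num_real // expr1n.
  have := sqr_ge0 s; nra.
have xE : x = a * s - b * t by rewrite -[LHS]mul1r -ab1 /s /t; ring.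
have yE : y = b * s + a * t by rewrite -[LHS]mul1r -ab1 /s /t; ring.
have a1 : `|a| <= 1 by rewrite -(@ler_pXn2r _ 2) ?nnegrE // real_normK ?num_real // expr1n -ab1 lerDl sqr_ge0.
have b1 : `|b| <= 1 by rewrite -(@ler_pXn2r _ 2) ?nnegrE // real_normK ?num_real // expr1n -ab1 lerDr sqr_ge0.
have comb (u v k : R) : `|u| <= 1 -> `|v| <= 1 -> `|k| <= 2 * D -> `|u * s + v * k| + eps <= 4 * D.
  move=> u1 v1 kD; have h1 : `|u * s| <= D by rewrite normrM (le_trans _ sD) // ler_piMl.
  have h2 : `|v * k| <= 2 * D by rewrite normrM (le_trans _ kD) // ler_piMl.
  by have := ler_normD (u * s) (v * k); lra.
have xy1 : (-1 <= x <= 1) && (-1 <= y <= 1).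
  by move: dp; rewrite /Defs.disc /= => dp; apply/andP; split; apply/andP; split; nra.
have /andP[x1 y1] := xy1.
have fin u v : `|x - u| + eps <= 4 * D -> `|y - v| + eps <= 4 * D ->
    (D ^+ 2)^-1 <= 16 * (spike eps u x * spike eps v y).
  move=> hu hv; rewrite /spike x1 y1.
  have u0 := spike_den_gt0 eps0 u x; have v0 := spike_den_gt0 eps0 v y.
  rewrite -invfM -[16]invrK -invfM lef_pV2 ?posrE ?exprn_gt0 ?mulr_gt0 ?invr_gt0 //.
  rewrite ler_pdivrMl // (_ : 16 * D ^+ 2 = (4 * D) * (4 * D)); last by ring.
  by apply: ler_pM => //; exact: ltW.
have sp u v : 0 <= spike eps u x * spike eps v y by rewrite mulr_ge0 ?spike_ge0.
have [t0|t0] := leP 0 t.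
  have kD : `|t - 1| <= 2 * D.
    move: tm t1; rewrite !(ger0_norm t0) => tm t1; rewrite ler0_norm; last by lra.
    have := sD; rewrite -/s; lra.
  apply: le_trans (fin (- b) a _ _) _.
  - rewrite (_ : x - - b = a * s + (- b) * (t - 1)); last by rewrite {1}xE; ring.
    by apply: comb; rewrite ?normrN.
  - rewrite (_ : y - a = b * s + a * (t - 1)); last by rewrite {1}yE; ring.
    exact: comb.
  - by rewrite ler_wpM2l // /omega lerDl.
have kD : `|t + 1| <= 2 * D.
  move: tm t1; rewrite !(ltr0_norm t0) => tm t1; rewrite ger0_norm; last by lra.
  have := sD; rewrite -/s; lra.
apply: le_trans (fin b (- a) _ _) _.
- rewrite (_ : x - b = a * s + (- b) * (t + 1)); last by rewrite {1}xE; ring.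
  by apply: comb; rewrite ?normrN.
- rewrite (_ : y - - a = b * s + a * (t + 1)); last by rewrite {1}yE; ring.
  exact: comb.
- by rewrite ler_wpM2l // /omega lerDr.
Qed.

Lemma omega_int : dint omega /\ dI omega <= 2 * logint eps ^+ 2.
Proof.
have a1 : -1 <= a <= 1 by have sb := sqr_ge0 b; have h1 := ab1; apply/andP; split; nra.
have b1 : -1 <= b <= 1 by have sa := sqr_ge0 a; have h1 := ab1; apply/andP; split; nra.
have a1' : -1 <= - a <= 1 by apply/andP; split; lra.
have b1' : -1 <= - b <= 1 by apply/andP; split; lra.
have [i1 h1] := spike2_int eps0 b1' a1; have [i2 h2] := spike2_int eps0 b1 a1'.
by split; [exact: dintD|rewrite dID //; lra].
Qed.

Lemma omega_ge0 p : 0 <= omega p.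
Proof. by rewrite /omega addr_ge0 ?mulr_ge0 ?spike_ge0. Qed.

(** [D = |1 - cconj z * w|] meets the hypotheses of [omega_lower] at both points simultaneously.
    Using that lower bound once for [p] and once for [q] gives [D ^ -4], with [256 = 16 ^ 2]. *)
Lemma kernel_bound (p q : RR) : disc p -> disc q ->
  0 <= a * p.1 + b * p.2 -> a * q.1 + b * q.2 <= 0 ->
  eps <= 1 - cabs (pt p) \/ eps <= 1 - cabs (pt q) ->
  csq (kernel (pt p) (pt q)) <= (disc_mass R)^-1 ^+ 2 * (256 * (omega p * omega q)).
Proof.
move=> dp dq sp sq epq; pose D := cabs (1 - cconj (pt p) * pt q).
have p1 := cabs_pt_lt1 dp; have q1 := cabs_pt_lt1 dq.
have p0 := cabs_ge0 (pt p); have q0 := cabs_ge0 (pt q).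
have Dpq : 1 - cabs (pt p) * cabs (pt q) <= D.
  have := sqrt_csqD (1 - cconj (pt p) * pt q) (cconj (pt p) * pt q).
  by rewrite subrK csq1 sqrtr1 -!/(cabs _) cabsM {1}/(cabs (cconj _)) csqC -/(cabs _) -/D; lra.
have Dp : 1 - cabs (pt p) <= D by nra.
have Dq : 1 - cabs (pt q) <= D by nra.
have D0 : 0 < D by lra.
have eD : eps <= D by case: epq; lra.
have D2 : D ^+ 2 = csq (1 - cconj (pt p) * pt q) by rewrite cabs_sqr.
(* From the identity [|1 - cconj z * w|^2 - |z - w|^2 = (1 - |z|^2) * (1 - |w|^2)]. *)
have dist : csq (pt p - pt q) <= D ^+ 2.
  have : 0 <= (1 - csq (pt p)) * (1 - csq (pt q)).
    by rewrite mulr_ge0 // subr_ge0 ltW // csq_pt_lt1.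
  rewrite D2 /csq !ReImE /=; nra.
(* The points lie on opposite sides of the line, so the sum of their distances to it is the
   component of [p - q] along the unit normal [(a, b)]. *)
have sD : a * p.1 + b * p.2 - (a * q.1 + b * q.2) <= D.
  have u0 : 0 <= a * p.1 + b * p.2 - (a * q.1 + b * q.2) by lra.
  rewrite -(@ler_pXn2r _ 2) ?nnegrE ?(ltW D0) //.
  apply: le_trans dist; rewrite /csq !ReImE /= -[leRHS]mul1r -ab1.
  have := sqr_ge0 (a * (p.2 - q.2) - b * (p.1 - q.1)); nra.
have hp := @omega_lower p D dp D0 eD; have hq := @omega_lower q D dq D0 eD.
have {}hp : (D ^+ 2)^-1 <= 16 * omega p by apply: hp => //; rewrite ger0_norm //; lra.
have {}hq : (D ^+ 2)^-1 <= 16 * omega q by apply: hq => //; rewrite ler0_norm //; lra.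
rewrite /kernel csqM csqV csqX csq_real -D2 ler_wpM2l ?sqr_ge0 //.
rewrite -exprVn expr2 (_ : 256 * _ = (16 * omega p) * (16 * omega q)); last by ring.
by apply: ler_pM; rewrite // invr_ge0 exprn_ge0 // ltW.
Qed.

End KernelBound.

(** * Separation and measurability of the sectors; size of the symbol *)

Section Sectors.
Variable R : realType.
Local Notation C := R[i].
Local Notation Re := (@complex.Re R).
Local Notation Im := (@complex.Im R).
Local Notation disc := (@disc R).
Local Notation RR := (measurableTypeR R * measurableTypeR R)%type.
Implicit Types (L j k : nat) (gamma : R).

Definition in_sector L j (z : C) := cabs z < 1 /\
  exists t, Defs.arc L j t /\ Re z = cabs z * cos t /\ Im z = cabs z * sin t.

Definition ang L j : R := 2 * pi * j%:R / L%:R.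

Lemma in_sectorP L j z : (0 < j)%N -> in_sector L j z -> exists t,
  [/\ ang L j.-1 <= t, t < ang L j, Re z = cabs z * cos t & Im z = cabs z * sin t].
Proof.
move=> j0 [_ [t [[t1 t2] [h1 h2]]]]; exists t; split => //.
by apply: le_trans t1; rewrite /ang -subn1 natrB.
Qed.

Lemma ang_diff L j k : (0 < L)%N -> ang L (j + k) = ang L j + ang L k.
Proof. by move=> L0; rewrite /ang natrD; field; rewrite pnatr_eq0 -lt0n. Qed.

Lemma ang_le_pi L n : (0 < L)%N -> (2 * n <= L)%N -> ang L n <= pi.
Proof.
move=> L0 nL; rewrite /ang ler_pdivrMr ?ltr0n //.
rewrite (_ : 2 * pi * n%:R = pi * (2 * n)%:R); last by rewrite natrM; ring.
by rewrite ler_wpM2l ?pi_ge0 // ler_nat.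
Qed.

Lemma ang_ge_pi L n : (0 < L)%N -> (L <= 2 * n)%N -> pi <= ang L n.
Proof.
move=> L0 nL; rewrite /ang ler_pdivlMr ?ltr0n // mulrAC [_ * pi]mulrC.
by rewrite ler_wpM2l ?pi_ge0 // -natrM ler_nat.
Qed.

Lemma ang_le_2pi L n : (0 < L)%N -> (n <= L)%N -> ang L n <= 2 * pi.
Proof.
move=> L0 nL; rewrite /ang ler_pdivrMr ?ltr0n //.
by rewrite ler_wpM2l ?mulr_ge0 ?pi_ge0 // ler_nat.
Qed.

Lemma ang_ge0 L n : 0 <= ang L n.
Proof. by rewrite /ang divr_ge0 ?mulr_ge0 ?pi_ge0 ?ler0n. Qed.

Lemma sin_le0 (x : R) : pi <= x <= 2 * pi -> sin x <= 0.
Proof.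
move=> /andP[x1 x2]; rewrite -[x](subrK pi) sinDpi oppr_le0.
by apply: sin_ge0_pi; apply/andP; split; lra.
Qed.

(* The line through the origin and the endpoint of sector j that lies on the shorter side
   towards sector k. *)
Lemma sector_separation_lt L j k : (0 < j < k)%N -> (k <= L)%N ->
  exists a b : R, a ^+ 2 + b ^+ 2 = 1 /\
    (forall z, in_sector L j z -> 0 <= a * Re z + b * Im z) /\
    (forall z, in_sector L k z -> a * Re z + b * Im z <= 0).
Proof.
move=> /andP[j0 jk] kL; have k0 : (0 < k)%N by exact: leq_trans jk.
have L0 : (0 < L)%N by exact: leq_trans kL.
have L2' : (2 <= L)%N by apply: leq_trans kL; apply: leq_trans jk.
have ang1 : ang L j = ang L j.-1 + ang L 1 by rewrite -ang_diff // addn1 prednK.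
have [kj|kj] := leqP (2 * (k - j)) L.
(* Sector [k] ends at most half a turn after [ang L j], and sector [j] lies within half a turn
   before it, as [2 <= L]. *)
- exists (sin (ang L j)), (- cos (ang L j)); split; first by rewrite sqrrN addrC cos2Dsin2.
  split=> z.
    move=> /(in_sectorP j0)[t [t1 t2 -> ->]].
    rewrite (_ : _ + _ = cabs z * sin (ang L j - t)); last by rewrite sinB; ring.
    rewrite mulr_ge0 ?cabs_ge0 // sin_ge0_pi //.
    have : ang L 1 <= pi by rewrite ang_le_pi.
    by move=> ?; apply/andP; split; lra.
  move=> /(in_sectorP k0)[t [t1 t2 -> ->]].
  rewrite (_ : _ + _ = - (cabs z * sin (t - ang L j))); last by rewrite sinB; ring.
  rewrite oppr_le0 mulr_ge0 ?cabs_ge0 // sin_ge0_pi //.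
  have h1 : ang L k = ang L j + ang L (k - j) by rewrite -ang_diff // subnKC // ltnW.
  have h2 : ang L k.-1 = ang L j + ang L (k.-1 - j) by rewrite -ang_diff // subnKC // -ltnS prednK.
  have h3 : ang L (k - j) <= pi by rewrite ang_le_pi.
  have h4 := ang_ge0 L (k.-1 - j).
  by apply/andP; split; lra.
(* Sector [k] now starts at least half a turn after [ang L j.-1] and ends within a full turn, where
   the sine is nonpositive. *)
exists (- sin (ang L j.-1)), (cos (ang L j.-1)); split; first by rewrite sqrrN addrC cos2Dsin2.
split=> z.
  move=> /(in_sectorP j0)[t [t1 t2 -> ->]].
  rewrite (_ : _ + _ = cabs z * sin (t - ang L j.-1)); last by rewrite sinB; ring.
  rewrite mulr_ge0 ?cabs_ge0 // sin_ge0_pi //.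
  have : ang L 1 <= pi by rewrite ang_le_pi.
  by move=> ?; apply/andP; split; lra.
move=> /(in_sectorP k0)[t [t1 t2 -> ->]].
rewrite (_ : _ + _ = cabs z * sin (t - ang L j.-1)); last by rewrite sinB; ring.
rewrite mulr_ge0_le0 ?cabs_ge0 // sin_le0 //.
have h1 : ang L k = ang L j.-1 + ang L (k - j.-1).
  by rewrite -ang_diff // subnKC // (leq_trans (leq_pred j)) // ltnW.
have h2 : ang L k.-1 = ang L j.-1 + ang L (k - j).
  by rewrite -ang_diff //; congr (ang L _); lia.
have h3 : pi <= ang L (k - j) by rewrite ang_ge_pi // ltnW.
have h4 : ang L (k - j.-1) <= 2 * pi by rewrite ang_le_2pi //; lia.
by apply/andP; split; lra.
Qed.

Lemma sector_separation L j k : (1 <= j <= L)%N -> (1 <= k <= L)%N -> j != k ->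
  exists a b : R, a ^+ 2 + b ^+ 2 = 1 /\
    (forall z, in_sector L j z -> 0 <= a * Re z + b * Im z) /\
    (forall z, in_sector L k z -> a * Re z + b * Im z <= 0).
Proof.
move=> /andP[j0 jL] /andP[k0 kL]; rewrite neq_ltn => /orP[jk|kj].
  by apply: sector_separation_lt => //; rewrite j0.
have [|a [b [ab [h1 h2]]]] := @sector_separation_lt L k j _ jL; first by rewrite k0.
exists (- a), (- b); split; first by rewrite !sqrrN.
split=> z hz; first by have := h2 z hz; rewrite !mulNr; lra.
by have := h1 z hz; rewrite !mulNr; lra.
Qed.

(* On the ray at angle ang L j.-1, both sines may vanish when L = 2; the last clause
   tells the two halves of that line apart. *)
Definition sectorb L j (z : C) : bool :=
  let a := ang L j.-1 in let b := ang L j in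
  (csq z <= 0) || ((0 <= Im z * cos a - Re z * sin a) &&
    ((Im z * cos b - Re z * sin b < 0) ||
     ((Im z * cos a - Re z * sin a <= 0) && (0 < Re z * cos a + Im z * sin a)))).

(** For measurability: [chi] tests the existence of an angle, while [sectorb] is a Boolean
    combination of inequalities between continuous functions. Conversely, the angle is recovered as
    [a + acos X], where [(X, Y)] is [z / |z|] turned by [- a]. *)
Lemma sectorbP L j p : (2 <= L)%N -> (0 < j)%N -> disc p ->
  in_sector L j (pt p) <-> sectorb L j (pt p).
Proof.
move=> L2' j0 dp; set z := pt p; have L0 : (0 < L)%N by exact: ltnW.
have ang1 : ang L j = ang L j.-1 + ang L 1 by rewrite -ang_diff // addn1 prednK.
have h1 : ang L 1 <= pi by rewrite ang_le_pi.
have h0 : 0 < ang L 1 by rewrite /ang divr_gt0 ?ltr0n // !mulr_gt0 ?pi_gt0.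
rewrite /sectorb /=; set a := ang L j.-1 in ang1 *; set b := ang L j in ang1 *.
split.
  move=> /(in_sectorP j0)[t [t1 t2 rz iz]]; rewrite -/a -/b in t1 t2.
  have [z0|z0] := leP (csq z) 0 => //=.
  have m0 : 0 < cabs z by rewrite sqrtr_gt0.
  have sE u : Im z * cos u - Re z * sin u = cabs z * sin (t - u) by rewrite rz iz sinB; ring.
  have cE u : Re z * cos u + Im z * sin u = cabs z * cos (t - u) by rewrite rz iz cosB; ring.
  rewrite !sE cE !pmulr_rge0 // pmulr_rlt0 // pmulr_rle0 // pmulr_rgt0 //.
  rewrite sin_ge0_pi /=; last by apply/andP; split; lra.
  have [->|ta] := eqVneq t a; first by rewrite subrr sin0 cos0 lexx ltr01 orbT.
  apply/orP; left; rewrite -[t - b]opprK sinN oppr_lt0 sin_gt0_pi //.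
  have : a < t by rewrite lt_neqAle eq_sym ta.
  by move=> ?; apply/andP; split; lra.
move=> hz; split; first exact: cabs_pt_lt1.
have [t [t1 t2 rz iz]] : exists t, [/\ a <= t, t < b, Re z = cabs z * cos t & Im z = cabs z * sin t].
  move: hz; have [z0 _|z0 /=] := leP (csq z) 0.
    have {}z0 : csq z = 0 by apply/eqP; rewrite eq_le z0 csq_ge0.
    exists a; split => //; first by lra.
    - by rewrite /cabs z0 sqrtr0 mul0r (csq_eq0 z0).
    - by rewrite /cabs z0 sqrtr0 mul0r (csq_eq0 z0).
  have m0 : 0 < cabs z by rewrite sqrtr_gt0.
  have cs := cos2Dsin2 a.
  pose X := (Re z * cos a + Im z * sin a) / cabs z.
  pose Y := (Im z * cos a - Re z * sin a) / cabs z.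
  have mX : cabs z * X = Re z * cos a + Im z * sin a by rewrite mulrC divfK ?gt_eqF.
  have mY : cabs z * Y = Im z * cos a - Re z * sin a by rewrite mulrC divfK ?gt_eqF.
  have XY : X ^+ 2 + Y ^+ 2 = 1.
    rewrite !expr_div_n -mulrDl cabs_sqr.
    have -> : (Re z * cos a + Im z * sin a) ^+ 2 + (Im z * cos a - Re z * sin a) ^+ 2 = csq z * (cos a ^+ 2 + sin a ^+ 2).
      by rewrite /csq; ring.
    by rewrite cs mulr1 divff // gt_eqF.
  have X1 : -1 <= X <= 1 by apply/andP; split; have := sqr_ge0 Y; nra.
  move=> /andP[Y0' hz].
  have Y0 : 0 <= Y by rewrite divr_ge0 ?cabs_ge0.
  pose u := acos X; have [/andP[u0 upi] cu] := acos_def X1; rewrite -/u in u0 upi cu.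
  have su : sin u = Y.
    by rewrite sin_acos // -XY addrAC subrr add0r sqrtr_sqr ger0_norm.
  have rE : Re z = cabs z * cos (a + u).
    rewrite cosD cu su.
    transitivity (cos a * (cabs z * X) - sin a * (cabs z * Y)); last by ring.
    rewrite mX mY; transitivity (Re z * (cos a ^+ 2 + sin a ^+ 2)); last by ring.
    by rewrite cs mulr1.
  have iE : Im z = cabs z * sin (a + u).
    rewrite sinD cu su.
    transitivity (sin a * (cabs z * X) + cos a * (cabs z * Y)); last by ring.
    rewrite mX mY; transitivity (Im z * (cos a ^+ 2 + sin a ^+ 2)); last by ring.
    by rewrite cs mulr1.
  exists (a + u); split => //; first by rewrite lerDl.
  (* In the first case [b <= a + u] would put [a + u - b] in [[0, pi]], where the sine is
     nonnegative. In the second, [z] lies on the initial ray and [u = 0]. *)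
  case/orP: hz => [hb|/andP[hs hc]].
    rewrite ltNge; apply/negP => bu; move: hb; apply/negP; rewrite -leNgt.
    have -> : Im z * cos b - Re z * sin b = cabs z * sin (a + u - b).
      by rewrite {1}rE {1}iE sinB; ring.
    by rewrite mulr_ge0 ?cabs_ge0 // sin_ge0_pi //; apply/andP; split; lra.
  have {}Y0 : Y = 0.
    by apply/eqP; rewrite eq_le Y0 andbT; rewrite pmulr_lle0 // invr_gt0.
  have X0 : 0 < X by rewrite divr_gt0.
  have {}X1 : X = 1.
    have : (X - 1) * (X + 1) = 0 by rewrite -subr_sqr expr1n -XY Y0 expr0n addr0 subrr.
    by move=> /eqP; rewrite mulf_eq0 => /orP[] /eqP; lra.
  have -> : u = 0 by rewrite /u X1 acos1.
  by lra.
exists t; split => //; split => //.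
by apply: le_trans t1; rewrite /a /ang -[X in _ <= _ * X%:R / _]subn1 natrB.
Qed.

Definition phi gamma (z : C) : R := phi0 gamma (cabs z).

Lemma chiE gamma L j z : in_sector L j z -> chi gamma L j z = Complex (phi gamma z) 0.
Proof. by move=> h; rewrite /chi; case: asboolP. Qed.
Lemma chi0 gamma L j z : ~ in_sector L j z -> chi gamma L j z = 0.
Proof. by move=> h; rewrite /chi; case: asboolP. Qed.

Lemma phi_base_ge1 (r : R) : 0 <= r < 1 -> 1 <= 1 + ln ((1 - r)^-1).
Proof.
move=> /andP[r0 r1]; rewrite lerDl ln_ge0 // invf_ge1 ?subr_gt0 //; lra.
Qed.

Lemma phi_ge0 gamma z : 0 <= phi gamma z. Proof. exact: powR_ge0. Qed.

Lemma phi_le1 gamma z : 0 < gamma -> cabs z < 1 -> phi gamma z <= 1.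
Proof.
move=> g0 z1; rewrite /phi /phi0 -[leRHS](powRr0 (1 + ln ((1 - cabs z)^-1))).
by apply: ler_powR; [apply: phi_base_ge1; rewrite cabs_ge0|rewrite oppr_le0 ltW].
Qed.

Lemma phi_outer gamma (K : R) z : 0 < gamma -> 0 < K -> cabs z < 1 -> 1 - cabs z < expR (- K) ->
  phi gamma z <= K `^ (- gamma).
Proof.
move=> g0 K0 z1 zK; rewrite /phi /phi0 !powRN.
have d0 : 0 < 1 - cabs z by rewrite subr_gt0.
have KB : K <= 1 + ln ((1 - cabs z)^-1).
  rewrite lnV ?posrE // -lerBlDl; apply: (@le_trans _ _ K); first by lra.
  rewrite lerNr -[leRHS](expRK (- K)) ler_ln ?posrE ?expR_gt0 //; exact: ltW.
have B0 : 0 < 1 + ln ((1 - cabs z)^-1) by exact: lt_le_trans KB.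
rewrite lef_pV2 ?posrE ?powR_gt0 //.
by apply: ge0_ler_powR => //; rewrite ?nnegrE ltW.
Qed.

Lemma measurable_cabs : measurable_fun (disc : set RR) (fun p => cabs (pt p)).
Proof.
have ms : measurable_fun (setT : set R) (fun x : R => Num.sqrt x).
  by apply: continuous_measurable_fun; exact: sqrt_continuous.
by apply: (measurableT_comp ms); exact: (cmeas_csq (cmeas_id R)).
Qed.

Lemma cmeas_chi gamma L j : (2 <= L)%N -> (0 < j)%N -> cmeas (chi gamma L j).
Proof.
move=> L2' j0.
have [mR mI] := cmeas_id R.
have mlin (a b : R) : measurable_fun (disc : set RR) (fun p => Im (pt p) * a + Re (pt p) * b).
  by apply: measurable_funD; apply: measurable_funM => //; exact: measurable_cst.
have mc (c : R) : measurable_fun (disc : set RR) (fun=> c) by exact: measurable_cst.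
have mS : measurable_fun (disc : set RR) (fun p => sectorb L j (pt p)).
  apply: measurable_or; first by apply: measurable_fun_ler => //; exact: (cmeas_csq (cmeas_id R)).
  have mm a : measurable_fun (disc : set RR) (fun p => Im (pt p) * cos a - Re (pt p) * sin a).
    by have := mlin (cos a) (- sin a); under eq_fun do rewrite mulrN.
  apply: measurable_and; first exact: measurable_fun_ler.
  apply: measurable_or; first exact: measurable_fun_ltr.
  apply: measurable_and; first exact: measurable_fun_ler.
  apply: measurable_fun_ltr => //.
  by have := mlin (sin (ang L j.-1)) (cos (ang L j.-1)); under eq_fun do rewrite addrC.
have mphi : measurable_fun (disc : set RR) (fun p => phi gamma (pt p)).
  apply: (measurableT_comp (measurable_powR _)).
  apply: measurable_funD => //.
  apply: (eq_measurable_fun (fun p => - ln (1 - cabs (pt p)))).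
    by move=> p /set_mem dp; rewrite lnV // posrE subr_gt0 cabs_pt_lt1.
  apply: measurable_funN; apply: (measurableT_comp (@measurable_ln R)).
  by apply: measurable_funB => //; exact: measurable_cabs.
have mif : measurable_fun (disc : set RR) (fun p => if sectorb L j (pt p) then phi gamma (pt p) else 0).
  apply: measurable_fun_if => //.
  - exact: measurable_disc.
  - by apply: (measurable_funS _ _ mphi); [exact: measurable_disc|exact: subIsetl].
split.
  apply: eq_measurable_fun mif => p /set_mem dp; have := sectorbP L2' j0 dp.
  by case: ifP => _ [h1 h2]; [rewrite chiE //; exact: h2|rewrite chi0 // => /h1].
apply: eq_measurable_fun (mc 0) => p /set_mem dp; rewrite /chi; by case: ifP.
Qed.

End Sectors.

(** * Toeplitz operators, adjoints, and greedy orthonormal families *)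

Section BergmanSpace.
Variable R : realType.
Local Notation C := R[i].
Local Notation Re := (@complex.Re R).
Local Notation Im := (@complex.Im R).
Local Notation disc := (@disc R).
Local Notation RR := (measurableTypeR R * measurableTypeR R)%type.
Implicit Types f g u v : C -> C.

Lemma bergmanD f g : bergman f -> bergman g -> bergman (fun z => f z + g z).
Proof.
move=> [[a fa] Lf] [[b gb] Lg]; split; last exact: L2D.
exists (fun n => a n + b n) => p dp; have [f1 f2] := fa p dp; have [g1 g2] := gb p dp.
have E N : \sum_(n < N) (a n + b n) * pt p ^+ n = \sum_(n < N) a n * pt p ^+ n + \sum_(n < N) b n * pt p ^+ n.
  by rewrite -big_split; apply: eq_bigr => i _; rewrite mulrDl.
split.
  by under eq_fun do rewrite E Re_add; rewrite Re_add; exact: cvgD.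
by under eq_fun do rewrite E Im_add; rewrite Im_add; exact: cvgD.
Qed.

Lemma bergmanZ c f : bergman f -> bergman (fun z => c * f z).
Proof.
move=> [[a fa] Lf]; split; last exact: L2Z.
exists (fun n => c * a n) => p dp.
have E N : \sum_(n < N) (c * a n) * pt p ^+ n = c * \sum_(n < N) a n * pt p ^+ n.
  by rewrite mulr_sumr; apply: eq_bigr => i _; rewrite mulrA.
by have [h1 h2] := ccvgM c (fa p dp); split; under eq_fun do rewrite E.
Qed.

Lemma bergmanB f g : bergman f -> bergman g -> bergman (fun z => f z - g z).
Proof.
move=> bf bg; have := bergmanD bf (bergmanZ (-1) bg).
by congr bergman; apply/funext => z; rewrite mulN1r.
Qed.

Lemma bergman0 : bergman (fun=> 0 : C).
Proof.
split; last exact: L2_0.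
exists (fun=> 0) => p _; have E N : \sum_(n < N) (0 : C) * pt p ^+ n = 0.
  by apply: big1 => i _; rewrite mul0r.
by split; under eq_fun do rewrite E; exact: cvg_cst.
Qed.

Lemma bergman_sum n (F : nat -> C -> C) : (forall i, bergman (F i)) ->
  bergman (fun z => \sum_(i < n) F i z).
Proof.
move=> bF; elim: n => [|n IH].
  by have := bergman0; congr bergman; apply/funext => z; rewrite big_ord0.
have := bergmanD IH (bF n).
by congr bergman; apply/funext => z; rewrite big_ord_recr.
Qed.

Lemma bergman_L2 f : bergman f -> L2 f. Proof. by case. Qed.

(** The difference is a Bergman function, so both defining relations can be tested on it. Equality
    as functions on [C] is out of reach, since values off the disc are unconstrained. *)
Lemma bergman_proj_unique u g1 g2 : L2 u -> is_bergman_proj u g1 -> is_bergman_proj u g2 ->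
  nsq (fun z => g1 z - g2 z) = 0.
Proof.
move=> Lu [b1 h1] [b2 h2]; have b12 := bergmanB b1 b2.
have L1 := bergman_L2 b1; have L22 := bergman_L2 b2; have L12 := bergman_L2 b12.
have e1 := h1 _ b12; have e2 := h2 _ b12.
rewrite (innerBl Lu L1 L12) in e1; rewrite (innerBl Lu L22 L12) in e2.
rewrite /nsq innerBl //.
have -> : inner g1 (fun z => g1 z - g2 z) = inner u (fun z => g1 z - g2 z).
  by apply/eqP; rewrite eq_sym -subr_eq0 e1.
have -> : inner g2 (fun z => g1 z - g2 z) = inner u (fun z => g1 z - g2 z).
  by apply/eqP; rewrite eq_sym -subr_eq0 e2.
by rewrite subrr.
Qed.

Lemma Pplus_spec u : L2 u -> is_bergman_proj u (Pplus u).
Proof. by move=> Lu; apply: epsilon_spec; exists (proj u); exact: proj_is_proj. Qed.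

Section RealSymbol.
Variable phi : C -> C.
Hypothesis mphi : cmeas phi.
Hypothesis phi1 : forall p, disc p -> csq (phi (pt p)) <= 1.
Hypothesis rphi : forall z, cconj (phi z) = phi z.

Lemma L2_symbol f : L2 f -> L2 (fun z => phi z * f z).
Proof.
move=> Lf; apply: (@L2_dom _ _ f 1) => //; first exact/cmeasM/L2_meas.
by move=> p dp; rewrite csqM ler_wpM2r ?csq_ge0 ?phi1.
Qed.

Lemma toeplitz_spec f : bergman f -> is_bergman_proj (fun z => phi z * f z) (toeplitz phi f).
Proof. by move=> /bergman_L2 Lf; apply: Pplus_spec; exact: L2_symbol. Qed.

Lemma inner_symbol f g : inner (fun z => phi z * f z) g = inner f (fun z => phi z * g z).
Proof. by apply: cint_ext => p _; rewrite cconjM rphi; ring. Qed.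

Lemma inner_toeplitz f g : bergman f -> bergman g ->
  inner (toeplitz phi f) g = inner f (fun z => phi z * g z).
Proof.
move=> bf bg; have [bT /(_ g bg)] := toeplitz_spec bf.
have Lf := bergman_L2 bf; have Lg := bergman_L2 bg; have LT := bergman_L2 bT.
rewrite (innerBl (L2_symbol Lf) LT Lg) inner_symbol => /eqP.
by rewrite subr_eq0 => /eqP.
Qed.

(** With a real symbol the adjoint solves the same projection problem as [toeplitz phi], so both
    products of the theorem get one description. [proj] first provides the witness without which
    [epsilon] would return an arbitrary function. *)
Lemma adjoint_spec g : bergman g ->
  is_bergman_proj (fun z => phi z * g z) (adjoint (toeplitz phi) g).
Proof.
move=> bg; have Lg := bergman_L2 bg; have Lpg := L2_symbol Lg.
have [bP hP] := proj_is_proj Lpg.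
have ex : exists h, bergman h /\ forall f, bergman f -> inner (toeplitz phi f) g = inner f h.
  exists (proj (fun z => phi z * g z)); split => // f bf.
  have Lf := bergman_L2 bf; have LP := bergman_L2 bP.
  rewrite inner_toeplitz // (innerC Lpg Lf) (innerC LP Lf); congr cconj.
  by have /eqP := hP f bf; rewrite (innerBl Lpg LP Lf) subr_eq0 => /eqP.
have [bA hA] := epsilon_spec (inhabits (fun _ => 0)) _ ex.
split=> // f bf; have Lf := bergman_L2 bf; have LA := bergman_L2 bA.
rewrite (innerBl Lpg LA Lf); apply/eqP; rewrite subr_eq0; apply/eqP.
have := hA f bf; rewrite inner_toeplitz // (innerC Lpg Lf) (innerC LA Lf).
by move=> /(congr1 (@cconj R)); rewrite !cconjK.
Qed.

End RealSymbol.

(* Otherwise one could pick [n.+1] orthonormal vectors [e_i], each orthogonal to the previous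
   ones, with [nsq (B e_i) > H / n.+1], against the Hilbert--Schmidt bound [H]. *)
Lemma greedy_complement (B : operator R) (H : R) n :
  0 <= H ->
  (forall c g, bergman g -> nsq (B (fun z => c * g z)) = csq c * nsq (B g)) ->
  (forall g, bergman g -> nsq g = 0 -> nsq (B g) = 0) ->
  (forall m (e : nat -> C -> C), (forall i, bergman (e i)) ->
    (forall i j, (i < m)%N -> (j < m)%N -> inner (e i) (e j) = (i == j)%:R) ->
    \sum_(i < m) nsq (B (e i)) <= H) ->
  exists m (e : nat -> C -> C), [/\ (m <= n)%N, (forall i, bergman (e i)),
    (forall i j, (i < m)%N -> (j < m)%N -> inner (e i) (e j) = (i == j)%:R) &
    forall g, bergman g -> (forall i, (i < m)%N -> inner g (e i) = 0) ->
      nsq (B g) <= H / n.+1%:R * nsq g].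
Proof.
move=> H0 BZ Bnull Bsum; set tau := H / n.+1%:R.
have tau0 : 0 <= tau by rewrite divr_ge0.
apply: contrapT => no.
have step m : (m <= n.+1)%N -> exists e : nat -> C -> C, [/\ (forall i, bergman (e i)),
    (forall i j, (i < m)%N -> (j < m)%N -> inner (e i) (e j) = (i == j)%:R) &
    forall i, (i < m)%N -> tau < nsq (B (e i))].
  elim: m => [_|m IH mn]; first by exists (fun=> fun=> 0); split => // i; exact: bergman0.
  have [e [be oe te]] := IH (ltnW mn).
  (* If no such [g] existed, the family found so far, of size [m <= n], would already have the
     required property, against [no]. *)
  have [g [bg og gt]] : exists g, [/\ bergman g, (forall i, (i < m)%N -> inner g (e i) = 0) &
      tau * nsq g < nsq (B g)].
    apply: contrapT => nog; apply: no; exists m, e; split => // g bg og.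
    by rewrite leNgt; apply/negP => lt; apply: nog; exists g.
  (* [B] sends null functions to null functions, so the strict inequality rules out [nsq g = 0]; by
     homogeneity it survives normalisation of [g]. *)
  have g0 : 0 < nsq g.
    rewrite lt_neqAle nsq_ge0 andbT; apply/eqP => /esym g0.
    by move: gt; rewrite g0 mulr0 Bnull // ltxx.
  pose c : C := Complex (Num.sqrt (nsq g)^-1) 0.
  have cg : csq c = (nsq g)^-1 by rewrite csq_real sqr_sqrtr // invr_ge0 nsq_ge0.
  pose h z := c * g z.
  have Lg := bergman_L2 bg; have bh : bergman h by exact: bergmanZ.
  have hh : inner h h = 1.
    rewrite inner_self; last exact: bergman_L2.
    by rewrite nsqZ // cg mulVf ?gt_eqF.
  have he i : (i < m)%N -> inner h (e i) = 0.
    by move=> im; rewrite innerZl ?og ?mulr0 //; exact: bergman_L2.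
  exists (fun i => if i == m then h else e i); split.
  - by move=> i; case: eqP.
  - move=> i j iS jS.
    have lt x : (x < m.+1)%N -> x != m -> (x < m)%N.
      by rewrite ltnS leq_eqVlt => /predU1P[->|//]; rewrite eqxx.
    case: (eqVneq i m) => [im|im]; case: (eqVneq j m) => [jm|jm].
    + by rewrite im jm eqxx hh.
    + by rewrite im eq_sym (negbTE jm) he // lt.
    + rewrite jm (negbTE im) (innerC (bergman_L2 bh) (bergman_L2 (be i))).
      by rewrite he ?cconj0 // lt.
    + by rewrite oe ?lt.
  - move=> i; rewrite ltnS leq_eqVlt; case: eqP => [_ _|_ /= im]; last exact: te.
    by rewrite BZ // cg mulrC ltr_pdivlMr.
have [e [be oe te]] := step n.+1 (leqnn _).
have : H < H.
  apply: lt_le_trans (Bsum _ e be oe).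
  have -> : H = \sum_(i < n.+1) tau by rewrite sumr_const card_ord -mulr_natr divfK.
  rewrite !big_ord_recr /=; apply: ler_ltD; last exact: te.
  by apply: ler_sum => i _; apply/ltW/te; rewrite ltnS ltnW.
by rewrite ltxx.
Qed.

End BergmanSpace.

(** * Singular values of a product with a dominated kernel *)

Section SingularValueBound.
Variable R : realType.
Local Notation C := R[i].
Local Notation Re := (@complex.Re R).
Local Notation disc := (@disc R).
Local Notation RR := (measurableTypeR R * measurableTypeR R)%type.
(** [X] and [Y] stand for the symbols of the two sectors, [Xo] and [Yo] for their restrictions to a
    thin ring at the circle, where they are at most [delta]. The hypothesis [kb] dominates the
    kernel that is left. *)
Variables (X Y Xo Yo : C -> C) (delta c W : R) (om : RR -> R).
Hypotheses (mX : cmeas X) (mY : cmeas Y) (mXo : cmeas Xo) (mYo : cmeas Yo).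
Hypothesis X1 : forall p, disc p -> csq (X (pt p)) <= 1.
Hypothesis Y1 : forall p, disc p -> csq (Y (pt p)) <= 1.
Hypothesis Xod : forall p, disc p -> csq (Xo (pt p)) <= delta ^+ 2.
Hypothesis Yod : forall p, disc p -> csq (Yo (pt p)) <= delta ^+ 2.
Hypothesis c0 : 0 <= c.
Hypothesis om0 : forall p, 0 <= om p.
Hypothesis iom : dint om.
Hypothesis omW : dI om <= W.
Hypothesis kb : forall p q, disc p -> disc q ->
  csq ((X (pt p) * Y (pt q) - Xo (pt p) * Yo (pt q)) * kernel (pt p) (pt q)) <= c * (om p * om q).

Let L2_mul (s : C -> C) (f : C -> C) (d : R) : cmeas s ->
  (forall p, disc p -> csq (s (pt p)) <= d) -> L2 f -> L2 (fun z => s z * f z).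
Proof.
move=> ms sd Lf; apply: (@L2_dom _ _ f d) => //; first exact/cmeasM/L2_meas.
by move=> p dp; rewrite csqM ler_wpM2r ?csq_ge0 ?sd.
Qed.

Let nsq_mul (s : C -> C) (f : C -> C) (d : R) : 0 <= d -> cmeas s ->
  (forall p, disc p -> csq (s (pt p)) <= d) -> L2 f -> nsq (fun z => s z * f z) <= d * nsq f.
Proof.
move=> d0 ms sd Lf; apply: nsq_dom => //; first exact/cmeasM/L2_meas.
by move=> p dp; rewrite csqM ler_wpM2r ?csq_ge0 ?sd.
Qed.

(** The final projection is left out: it is a contraction and can be applied last, and without it
    [Bop f] has an explicit kernel at each point. *)
Definition Bop : operator R := fun f z =>
  X z * proj (fun w => Y w * f w) z - Xo z * proj (fun w => Yo w * f w) z.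

Lemma L2_Bop f : L2 f -> L2 (Bop f).
Proof.
move=> Lf; apply: L2B.
  by apply: (L2_mul mX X1); have [] := proj_L2 (L2_mul mY Y1 Lf).
by apply: (L2_mul mXo Xod); have [] := proj_L2 (L2_mul mYo Yod Lf).
Qed.

(** The coefficient is conjugated because [inner] conjugates its second argument. *)
Definition Bker (z w : C) : C := cconj (X z * Y w - Xo z * Yo w) * kernel z w.

Lemma csq_Bker p q : disc p -> disc q -> csq (Bker (pt p) (pt q)) <= c * (om p * om q).
Proof. by move=> dp dq; rewrite csqM csqC -csqM; exact: kb. Qed.

Lemma cmeas_Bker p : disc p -> cmeas (Bker (pt p)).
Proof.
move=> dp; apply: cmeasM; last exact/cmeas_kernel/cabs_pt_lt1.
apply: cmeas_conj; have := cmeasD (cmeasZ (X (pt p)) mY) (cmeasZ (- Xo (pt p)) mYo).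
by congr cmeas; apply/funext => w; rewrite mulNr.
Qed.

Lemma L2_Bker p : disc p -> L2 (Bker (pt p)).
Proof.
move=> dp; apply/L2P; split; first exact: cmeas_Bker.
apply: dint_le (dintZ (c * om p) iom) _; first exact: (cmeas_csq (cmeas_Bker dp)).
by move=> q dq; rewrite ger0_norm ?csq_ge0 // -mulrA csq_Bker.
Qed.

Lemma nsq_Bker p : disc p -> nsq (Bker (pt p)) <= c * (W / pi) * om p.
Proof.
move=> dp; rewrite nsqE.
have -> : c * (W / pi) * om p = (c * om p * W) / pi by ring.
rewrite ler_pM2r ?invr_gt0 ?pi_gt0 //.
apply: (@le_trans _ _ (c * om p * dI om)); last by rewrite ler_wpM2l // mulr_ge0.
rewrite -dIZ //; apply: dI_le; [exact/L2_csq/L2_Bker|exact: dintZ|].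
by move=> q dq; rewrite -mulrA csq_Bker.
Qed.

Lemma BopE f p : L2 f -> disc p -> Bop f (pt p) = inner f (Bker (pt p)).
Proof.
move=> Lf dp; have LK := L2_kernel (cabs_pt_lt1 dp).
have LY := L2_mul mY Y1 Lf; have LYo := L2_mul mYo Yod Lf.
rewrite /Bop /proj -(innerZl _ LY LK) -(innerZl _ LYo LK) -innerBl //; [|exact: L2Z|exact: L2Z].
by apply: cint_ext => q _; rewrite /Bker cconjM cconjK; ring.
Qed.

Lemma Bop_sum f n (e : nat -> C -> C) p (a : nat -> C) : L2 f -> (forall i, L2 (e i)) -> disc p ->
  Bop (fun z => f z - \sum_(i < n) a i * e i z) (pt p) =
  Bop f (pt p) - \sum_(i < n) a i * Bop (e i) (pt p).
Proof.
move=> Lf Le dp; have LK := L2_Bker dp.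
have La i : L2 (fun z => a i * e i z) by exact: L2Z.
have LS : L2 (fun z => \sum_(i < n) a i * e i z) by exact: (L2_sum (F := fun i z => a i * e i z)).
rewrite !BopE //; last exact: L2B.
rewrite innerBl // (inner_suml (F := fun i z => a i * e i z)) //; congr (_ - _).
by apply: eq_bigr => i _; rewrite BopE // innerZl.
Qed.

Lemma Bop_scale a f : L2 f -> nsq (Bop (fun z => a * f z)) = csq a * nsq (Bop f).
Proof.
move=> Lf; rewrite -nsqZ; last exact: L2_Bop.
apply: nsq_ext => p dp; rewrite !BopE ?innerZl //; [exact: L2_Bker|exact: L2Z].
Qed.

Lemma Bop_null f : L2 f -> nsq f = 0 -> nsq (Bop f) = 0.
Proof.
move=> Lf f0; rewrite (@nsq_ext _ _ (fun=> 0)); first by rewrite /nsq inner0l.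
move=> p dp; rewrite BopE //; apply/csq_eq0/eqP; rewrite eq_le csq_ge0 andbT.
by apply: le_trans (cauchy_schwarz Lf (L2_Bker dp)) _; rewrite f0 mul0r.
Qed.

(** For fixed [z], the numbers [Bop (e i) z] are the inner products of the [e i] with [Bker z], so
    Bessel bounds the sum of their squares by [nsq (Bker z)], at most a multiple of [om].
    Integrating in [z] gives a second [W / pi], with [pi] from the normalised measure. *)
Lemma Bop_HS m (e : nat -> C -> C) : (forall i, L2 (e i)) ->
  (forall i j, (i < m)%N -> (j < m)%N -> inner (e i) (e j) = (i == j)%:R) ->
  \sum_(i < m) nsq (Bop (e i)) <= c * (W / pi) ^+ 2.
Proof.
move=> Le oe.
have pw p : disc p -> \sum_(i < m) csq (Bop (e i) (pt p)) <= c * (W / pi) * om p.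
  move=> dp; have LK := L2_Bker dp; apply: le_trans (nsq_Bker dp).
  apply: le_trans (bessel_le (fun i _ => Le i) LK oe).
  by apply: ler_sum => i _; rewrite BopE // (innerC LK) // csqC.
have S k : dint (fun p => \sum_(i < k) csq (Bop (e i) (pt p))) /\
    \sum_(i < k) nsq (Bop (e i)) = dI (fun p => \sum_(i < k) csq (Bop (e i) (pt p))) / pi.
  elim: k => [|k [IH1 IH2]].
    split; first by apply: dint_ext (dint_cst 0) => p _; rewrite big_ord0.
    rewrite big_ord0 (@dI_ext _ _ (fun=> 0 * 1)); last by move=> p _; rewrite big_ord0 mul0r.
    by rewrite dIZ ?mul0r //; exact: dint_cst.
  have ie := L2_csq (L2_Bop (Le k)).
  split; first by apply: dint_ext (dintD IH1 ie) => p _; rewrite big_ord_recr.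
  rewrite big_ord_recr /= IH2 nsqE -mulrDl -dID //; congr (_ / _).
  by apply: dI_ext => p _; rewrite big_ord_recr.
have [i1 ->] := S m; have W0 : 0 <= W by apply: le_trans omW; exact: dI_ge0.
have -> : c * (W / pi) ^+ 2 = (c * (W / pi) * W) / pi by ring.
rewrite ler_pM2r ?invr_gt0 ?pi_gt0 //.
have cW0 : 0 <= c * (W / pi) by rewrite mulr_ge0 // divr_ge0 ?pi_ge0.
apply: (@le_trans _ _ (c * (W / pi) * dI om)); last exact: ler_wpM2l.
by rewrite -dIZ //; apply: dI_le => //; exact: dintZ.
Qed.

Lemma proj_sum f n (e : nat -> C -> C) p (a : nat -> C) : L2 f -> (forall i, L2 (e i)) -> disc p ->
  proj (fun z => f z - \sum_(i < n) a i * e i z) (pt p) =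
  proj f (pt p) - \sum_(i < n) a i * proj (e i) (pt p).
Proof.
move=> Lf Le dp; have LK := L2_kernel (cabs_pt_lt1 dp).
have La i : L2 (fun z => a i * e i z) by exact: L2Z.
have LS : L2 (fun z => \sum_(i < n) a i * e i z) by exact: (L2_sum (F := fun i z => a i * e i z)).
rewrite /proj innerBl // (inner_suml (F := fun i z => a i * e i z)) //; congr (_ - _).
by apply: eq_bigr => i _; rewrite innerZl.
Qed.

Lemma norm2_le (f : C -> C) (t s : R) : 0 <= t -> nsq f <= t ^+ 2 * s -> norm2 f <= t * Num.sqrt s.
Proof.
move=> t0 h; rewrite norm2E; apply: le_trans (ler_wsqrtr h) _.
by rewrite sqrtrM ?sqr_ge0 // sqrtr_sqr ger0_norm.
Qed.

(** [F] is the projection of [Bop] compressed to the span of the [e i]. Up to null functions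
    [A f - F f] is then the projection of [Bop r] plus the ring part, [r] being the component of [f]
    orthogonal to the [e i]; the greedy choice controls [Bop r]. *)
Lemma sing_val_bound (A : operator R) n :
  (forall f, bergman f -> exists u, is_bergman_proj (fun z => Y z * f z) u /\
    is_bergman_proj (fun z => X z * u z) (A f)) ->
  (sing_val A n <= (delta ^+ 2 + Num.sqrt (c * (W / pi) ^+ 2 / n.+1%:R))%:E)%E.
Proof.
move=> hA; set H := c * _.
have H0 : 0 <= H by rewrite mulr_ge0 // sqr_ge0.
have [m [e [mn be oe he]]] := @greedy_complement R Bop H n H0
  (fun a g bg => Bop_scale a (bergman_L2 bg)) (fun g bg => Bop_null (bergman_L2 bg))
  (fun m e be oe => Bop_HS (fun i => bergman_L2 (be i)) oe).
have Le i : L2 (e i) by exact/bergman_L2.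
have LBe i : L2 (Bop (e i)) by exact: L2_Bop.
(* [rank_le n] asks for sequences of Bergman functions and a sum of exactly [n] terms; the family
   has only [m <= n], so it is padded with zeros. *)
pose U i := if (i < m)%N then e i else fun=> 0.
pose V i := if (i < m)%N then proj (Bop (e i)) else fun=> 0.
pose F : operator R := fun f z => \sum_(i < n) inner f (U i) * V i z.
have FE f z : F f z = \sum_(i < m) inner f (e i) * proj (Bop (e i)) z.
  rewrite /F (big_ord_widen n (fun i => inner f (e i) * proj (Bop (e i)) z) mn) [RHS]big_mkcond.
  by apply: eq_bigr => i _; rewrite /U /V; case: ifP; rewrite ?mulr0.
have rF : rank_le n F.
  exists U, V; split => // i; rewrite /U /V; case: ifP => _; last by split; exact: bergman0.
  by split => //; have [] := proj_is_proj (LBe i).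
apply: (@le_trans _ _ (opnorm (fun f => A f \- F f))).
  by apply: ereal_inf_lbound; exists F.
apply: ge_ereal_sup => _ [f [bf f1] <-]; rewrite lee_fin.
have Lf := bergman_L2 bf; have [u [pu pA]] := hA f bf.
have [bu _] := pu; have Lu := bergman_L2 bu; have [bA _] := pA; have LA := bergman_L2 bA.
have LYf := L2_mul mY Y1 Lf; have LXu := L2_mul mX X1 Lu; have LYof := L2_mul mYo Yod Lf.
have [LPY nPY _] := proj_L2 LYf; have [LPX nPX _] := proj_L2 LXu; have [LPYo nPYo _] := proj_L2 LYof.
pose r z := f z - \sum_(i < m) inner f (e i) * e i z.
have br : bergman r.
  by apply: bergmanB => //; apply: (@bergman_sum _ m (fun i z => inner f (e i) * e i z)) => i; exact: bergmanZ.
have Lr := bergman_L2 br.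
have nr : nsq r <= nsq f.
  by rewrite bessel_residual // gerBl sumr_ge0 // => i _; exact: csq_ge0.
have or i : (i < m)%N -> inner r (e i) = 0.
  move=> im; have Lt j : L2 (fun z => inner f (e j) * e j z) by exact: L2Z.
  rewrite innerBl //; last exact: (L2_sum (F := fun i z => inner f (e i) * e i z)).
  rewrite (inner_suml (F := fun i z => inner f (e i) * e i z)) // (bigD1 (Ordinal im)) //=.
  rewrite innerZl // oe // eqxx mulr1 big1 ?addr0 ?subrr // => j /eqP ji.
  rewrite innerZl // oe // (_ : (_ == _) = false) ?mulr0 //.
  by apply/eqP => E; apply: ji; exact: val_inj.
(* [t1] is the null discrepancy between the chosen [u] and [proj], [t2] the Hilbert--Schmidt part on
   the residual, [t3] the ring part, where each symbol contributes one factor [delta]. *)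
pose t1 z := X z * (u z - proj (fun w => Y w * f w) z).
pose t2 z := Bop r z.
pose t3 z := Xo z * proj (fun w => Yo w * f w) z.
have LuP : L2 (fun z => u z - proj (fun w => Y w * f w) z) by exact: L2B.
have Lt1 : L2 t1 by exact: (L2_mul mX X1).
have Lt2 : L2 t2 by exact: L2_Bop.
have Lt3 : L2 t3 by exact: (L2_mul mXo Xod).
pose q z := X z * u z - \sum_(i < m) inner f (e i) * Bop (e i) z.
have Lq : L2 q.
  have LSB : L2 (fun z => \sum_(i < m) inner f (e i) * Bop (e i) z).
    by apply: (L2_sum (F := fun i z => inner f (e i) * Bop (e i) z)) => i _; exact: (L2Z _ (LBe i)).
  exact: (L2B LXu LSB).
have LAP : L2 (fun z => A f z - proj (fun w => X w * u w) z) by exact: L2B.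
have [Lpq npq _] := proj_L2 Lq.
have -> : norm2 (A f \- F f) = norm2 (fun z => (A f z - proj (fun w => X w * u w) z) + proj q z).
  congr (Num.sqrt _); apply: nsq_ext => p dp.
  have pq : proj q (pt p) = proj (fun w => X w * u w) (pt p) -
      \sum_(i < m) inner f (e i) * proj (Bop (e i)) (pt p).
    exact: (@proj_sum _ m (fun i => Bop (e i)) p (fun i => inner f (e i)) LXu LBe dp).
  by rewrite pq -FE /=; ring.
apply: le_trans (norm2D LAP Lpq) _.
have -> : norm2 (fun z => A f z - proj (fun w => X w * u w) z) = 0.
  by rewrite norm2E (bergman_proj_unique LXu pA (proj_is_proj LXu)) sqrtr0.
rewrite add0r; apply: (@le_trans _ _ (norm2 q)); first by rewrite !norm2E ler_wsqrtr.
have -> : norm2 q = norm2 (fun z => t1 z + (t2 z + t3 z)).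
  congr (Num.sqrt _); apply: nsq_ext => p dp.
  have t2E : t2 (pt p) = Bop f (pt p) - \sum_(i < m) inner f (e i) * Bop (e i) (pt p).
    exact: (@Bop_sum f m e p (fun i => inner f (e i)) Lf Le dp).
  by rewrite t2E /t1 /t3 /q {2}/Bop; ring.
have L23 := L2D Lt2 Lt3.
apply: le_trans (norm2D Lt1 L23) _.
have -> : norm2 t1 = 0.
  have z0 := bergman_proj_unique LYf pu (proj_is_proj LYf).
  have := nsq_mul ler01 mX X1 LuP; rewrite z0 mulr0 => h.
  rewrite norm2E (_ : nsq t1 = 0) ?sqrtr0 //.
  by apply/eqP; rewrite eq_le h nsq_ge0.
rewrite add0r addrC; apply: le_trans (norm2D Lt2 Lt3) _.
have sf1 : Num.sqrt (nsq f) <= 1 by [].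
rewrite lerD //.
  rewrite norm2E; apply: ler_wsqrtr; apply: le_trans (he r br or) _.
  rewrite ler_piMr ?divr_ge0 //; apply: le_trans nr _.
  by rewrite -(sqr_sqrtr (nsq_ge0 f)) exprn_ile1 ?sqrtr_ge0.
rewrite -[leRHS]mulr1; apply: le_trans (ler_wpM2l (sqr_ge0 _) sf1).
apply: norm2_le; first exact: sqr_ge0.
apply: le_trans (nsq_mul (sqr_ge0 _) mXo Xod LPYo) _.
rewrite [_ ^+ 2 ^+ 2]expr2 -mulrA ler_wpM2l ?sqr_ge0 //; apply: le_trans nPYo _.
exact: (nsq_mul (sqr_ge0 _) mYo Yod Lf).
Qed.

End SingularValueBound.

(** * Powers of logarithms against square roots *)

Section Asymptotics.
Variable R : realType.

Lemma ln_nat_large (M : R) : \forall n \near \oo, M <= ln (n.+1%:R : R).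
Proof.
exists (Num.bound (expR M)) => // n /= hn.
rewrite -[leLHS]expRK ler_ln ?posrE ?expR_gt0 ?ltr0n //.
apply: (@le_trans _ _ (Num.bound (expR M))%:R); last by rewrite ler_nat (leq_trans hn).
by apply/ltW/archi_boundP/expR_ge0.
Qed.

Lemma sqrt_natE n : Num.sqrt (n.+1%:R : R) = expR (ln n.+1%:R / 2).
Proof.
have e0 := expR_ge0 (ln (n.+1%:R : R) / 2).
rewrite -[RHS](ger0_norm e0) -sqrtr_sqr expr2 -expRD -splitr.
by rewrite lnK // posrE ltr0n.
Qed.

(** With [s ^ 2 = ln (n + 1)], taking logarithms reduces the claim to [d + 2 p ln s <= s ^ 2 / 2].
    Since [ln s <= s], it is enough that [s >= M]: then [s ^ 2 / 2 >= M s / 2 >= 2 p s + |d|]. *)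
Lemma ln_power_small (C1 e p : R) : 0 < C1 -> 0 < e -> 0 <= p ->
  \forall n \near \oo, C1 * (ln (n.+1%:R : R)) `^ p <= e * Num.sqrt n.+1%:R.
Proof.
move=> C0 e0 p0; pose d := ln C1 - ln e.
pose M := (4 * p + 2 * `|d| + 1).
have M1 : 1 <= M by rewrite /M lerDr addr_ge0 ?mulr_ge0.
apply: filterS (ln_nat_large (M ^+ 2)) => n.
rewrite sqrt_natE; set l := ln _ => lM.
have l0 : 0 < l by apply: lt_le_trans lM; rewrite exprn_gt0 // (lt_le_trans ltr01).
pose s := Num.sqrt l; have s2 : s ^+ 2 = l by rewrite sqr_sqrtr // ltW.
have s0 : 0 < s by rewrite sqrtr_gt0.
have sM : M <= s.
  by rewrite -(@ler_pXn2r _ 2) ?nnegrE ?s2 // ?(ltW s0) // (le_trans ler01).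
have ls : ln s <= s.
  by rewrite -ler_expR lnK ?posrE //; apply: le_trans (expR_ge1Dx _); lra.
have eC : C1 = expR (ln C1) by rewrite lnK ?posrE.
have ee : e = expR (ln e) by rewrite lnK ?posrE.
rewrite /powR gt_eqF // eC ee -!expRD ler_expR -s2 lnXn //.
have d1 : d <= `|d| by exact: ler_norm.
have dE : ln C1 = d + ln e by rewrite /d subrK.
have pls : p * ln s <= p * s by rewrite ler_wpM2l.
have : 0 <= `|d| by [].
rewrite dE -mulr_natl; rewrite /M in sM M1; nra.
Qed.

End Asymptotics.

(** * The bound for Toeplitz products and the choice of the cutoff *)

Section ToeplitzProduct.
Variable R : realType.
Local Notation C := R[i].
Local Notation disc := (@disc R).
Local Notation RR := (measurableTypeR R * measurableTypeR R)%type.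
Variables (gamma : R) (L : nat).
Hypothesis gamma0 : 0 < gamma.

Lemma cconj_chi j (z : C) : cconj (chi gamma L j z) = chi gamma L j z.
Proof. by rewrite /chi; case: ifP => _; rewrite ?cconj_real ?cconj0. Qed.

Lemma csq_chi_le j (p : RR) (d : R) : 0 <= d -> phi gamma (pt p) <= d ->
  csq (chi gamma L j (pt p)) <= d ^+ 2.
Proof.
move=> d0 pd; rewrite /chi; case: ifP => _; last by rewrite csq0 sqr_ge0.
by rewrite csq_real lerXn2r ?nnegrE ?phi_ge0.
Qed.

Lemma csq_chi_le1 j (p : RR) : disc p -> csq (chi gamma L j (pt p)) <= 1.
Proof.
move=> dp; rewrite -(expr1n R 2); apply: csq_chi_le => //.
by apply: phi_le1 => //; exact: cabs_pt_lt1.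
Qed.

Definition outer (eps : R) j (z : C) := if 1 - cabs z < eps then chi gamma L j z else 0.

Lemma cmeas_outer eps j : (2 <= L)%N -> (0 < j)%N -> cmeas (outer eps j).
Proof.
move=> L2' j0; have [mR mI] := cmeas_chi gamma L2' j0.
have mb : measurable_fun (disc : set RR) (fun p => 1 - cabs (pt p) < eps).
  apply: measurable_fun_ltr; last exact: measurable_cst.
  by apply: measurable_funB; [exact: measurable_cst|exact: measurable_cabs].
have mi (h : RR -> R) : measurable_fun (disc : set RR) h ->
    measurable_fun (disc : set RR) (fun p => if 1 - cabs (pt p) < eps then h p else 0).
  move=> mh; apply: measurable_fun_if => //.
  - exact: measurable_disc.
  - by apply: (measurable_funS _ _ mh); [exact: measurable_disc|exact: subIsetl].
split.
  by apply: eq_measurable_fun (mi _ mR) => p _; rewrite /outer; case: ifP.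
by apply: eq_measurable_fun (mi _ mI) => p _; rewrite /outer; case: ifP.
Qed.

(** The ring has width [eps = expR (- T)] with [T] free. The ring part gives the first term and
    grows as [T] decreases; the Hilbert--Schmidt part gives the second and grows with [T]. *)
Lemma toeplitz_product_sing_val (A : operator R) j k n (T : R) :
  (1 <= j <= L)%N -> (1 <= k <= L)%N -> j != k -> 0 < T ->
  (forall f, bergman f -> exists u, is_bergman_proj (fun z => chi gamma L j z * f z) u /\
    is_bergman_proj (fun z => chi gamma L k z * u z) (A f)) ->
  (sing_val A n <= ((T `^ (- gamma)) ^+ 2 +
    128 / disc_mass R / pi * (2 + T) ^+ 2 / Num.sqrt n.+1%:R)%:E)%E.
Proof.
move=> hj hk jk T0 hA; pose eps := expR (- T); have eps0 : 0 < eps := expR_gt0 _.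
have /andP[j0 jL] := hj; have /andP[k0 kL] := hk.
have L2' : (2 <= L)%N by move: jk; rewrite neq_ltn => /orP[?|?]; lia.
have [a [b [ab [sepk sepj]]]] : exists a b : R, a ^+ 2 + b ^+ 2 = 1 /\
    (forall z, in_sector L k z -> 0 <= a * complex.Re z + b * complex.Im z) /\
    (forall z, in_sector L j z -> a * complex.Re z + b * complex.Im z <= 0).
  by apply: sector_separation => //; rewrite eq_sym.
have [iom omW] := omega_int eps0 ab.
have m0 := disc_mass_gt0 R; have pi0 := pi_gt0 R.
pose c : R := (disc_mass R)^-1 ^+ 2 * 256.
have c0 : 0 <= c by exact: (mulr_ge0 (sqr_ge0 _) (ler0n R 256)).
have outd i (p : RR) : disc p -> csq (outer eps i (pt p)) <= (T `^ (- gamma)) ^+ 2.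
  move=> dp; rewrite /outer; case: ifP => [hp|_]; last by rewrite csq0 sqr_ge0.
  by apply: csq_chi_le; [exact: powR_ge0|apply: phi_outer => //; exact: cabs_pt_lt1].
have kb (p q : RR) : disc p -> disc q ->
    csq ((chi gamma L k (pt p) * chi gamma L j (pt q) - outer eps k (pt p) * outer eps j (pt q)) *
      kernel (pt p) (pt q)) <= c * (omega eps a b p * omega eps a b q).
  move=> dp dq; have o0 : 0 <= c * (omega eps a b p * omega eps a b q).
    by rewrite mulr_ge0 // mulr_ge0 // omega_ge0.
  have [sp|nsp] := pselect (in_sector L k (pt p)); last first.
    by rewrite /outer chi0 // if_same !mul0r subrr mul0r csq0.
  have [sq|nsq'] := pselect (in_sector L j (pt q)); last first.
    by rewrite /outer [chi gamma L j _]chi0 // if_same !mulr0 subrr mul0r csq0.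
  (* If one of the points is outside the ring, the product of the [outer] symbols vanishes and
     [kernel_bound] applies. If both are in the ring, the two products cancel. *)
  have fin : eps <= 1 - cabs (pt p) \/ eps <= 1 - cabs (pt q) ->
      csq (chi gamma L k (pt p) * chi gamma L j (pt q) * kernel (pt p) (pt q)) <=
      c * (omega eps a b p * omega eps a b q).
    move=> epq; rewrite csqM csqM -[leRHS]mul1r ler_pM ?mulr_ge0 ?csq_ge0 //.
      by rewrite -[leRHS](mulr1 1) ler_pM ?csq_ge0 ?csq_chi_le1.
    by rewrite /c -mulrA; apply: kernel_bound => //; [exact: (sepk _ sp)|exact: (sepj _ sq)].
  rewrite /outer; case: ltP => hp; last by rewrite mul0r subr0; apply: fin; left.
  case: ltP => hq; last by rewrite mulr0 subr0; apply: fin; right.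
  by rewrite subrr mul0r csq0.
have := sing_val_bound (cmeas_chi gamma L2' k0) (cmeas_chi gamma L2' j0)
  (cmeas_outer eps L2' k0) (cmeas_outer eps L2' j0) (@csq_chi_le1 k) (@csq_chi_le1 j)
  (@outd k) (@outd j) c0 (omega_ge0 eps0 a b) iom omW kb n hA.
move=> h; apply: le_trans h _; rewrite lee_fin lerD2l.
have l0 : 0 <= logint eps.
  rewrite /logint mulr_ge0 // ln_ge0 // ler_pdivlMr // mul1r; lra.
(* [- ln eps = T], and [ln (2 + eps) <= 1 + eps <= 2]. *)
have lT : logint eps <= 2 * (2 + T).
  rewrite /logint ler_wpM2l // lnM ?posrE ?invr_gt0 //; last by lra.
  rewrite lnV ?posrE // expRK opprK lerD2r.
  have e1 : eps <= 1 by rewrite -[leRHS]expR0 ler_expR oppr_le0 ltW.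
  rewrite (_ : 2 + eps = 1 + (1 + eps)); last by ring.
  by apply: le_trans (le_ln1Dx _) _; lra.
have W0 : 0 <= 2 * logint eps ^+ 2 / pi by apply: divr_ge0; [rewrite mulr_ge0 ?sqr_ge0|exact: ltW].
(* The square root of [c] is [16 / disc_mass], giving [32 / disc_mass / pi * logint ^ 2]; the bound
   [logint <= 2 * (2 + T)] then turns 32 into 128. *)
have sc : Num.sqrt (c * (2 * logint eps ^+ 2 / pi) ^+ 2 / n.+1%:R) =
    16 / disc_mass R * (2 * logint eps ^+ 2 / pi) / Num.sqrt n.+1%:R.
  have m16 : 0 <= 16 / disc_mass R by rewrite divr_ge0 // ltW.
  rewrite sqrtrM; last by rewrite mulr_ge0 ?sqr_ge0.
  rewrite sqrtrV; last by rewrite ler0n.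
  congr (_ / _).
  have -> : c * (2 * logint eps ^+ 2 / pi) ^+ 2 = (16 / disc_mass R * (2 * logint eps ^+ 2 / pi)) ^+ 2.
    by rewrite /c; move: (disc_mass R)^-1 (2 * logint eps ^+ 2 / pi) => u v; ring.
  by rewrite sqrtr_sqr ger0_norm // mulr_ge0.
rewrite sc ler_pM2r ?invr_gt0 ?sqrtr_gt0 ?ltr0n //.
have -> : 16 / disc_mass R * (2 * logint eps ^+ 2 / pi) = 32 / disc_mass R / pi * logint eps ^+ 2.
  by move: (disc_mass R)^-1 (pi^-1 : R) => u v; ring.
have -> : 128 / disc_mass R / pi * (2 + T) ^+ 2 = 32 / disc_mass R / pi * (2 * (2 + T)) ^+ 2.
  by move: (disc_mass R)^-1 (pi^-1 : R) => u v; ring.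
rewrite ler_wpM2l //; first by apply: divr_ge0; [apply: divr_ge0 => //|]; exact: ltW.
by rewrite lerXn2r ?nnegrE //; apply: le_trans lT.
Qed.

Lemma toeplitz_product_Sigma0 (A : operator R) j k :
  (1 <= j <= L)%N -> (1 <= k <= L)%N -> j != k ->
  (forall f, bergman f -> exists u, is_bergman_proj (fun z => chi gamma L j z * f z) u /\
    is_bergman_proj (fun z => chi gamma L k z * u z) (A f)) ->
  Sigma0 (2 * gamma) A.
Proof.
move=> hj hk jk hA e e0; have g0 := gamma0.
have m0 := disc_mass_gt0 R; have pi0 := pi_gt0 R.
(* Chosen so that [K ^ (- 2 gamma) = e / 2]: the ring part takes exactly half of the allowed
   constant. *)
pose K : R := (e / 2) `^ (- (2 * gamma)^-1).
have e20 : 0 < e / 2 by rewrite divr_gt0.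
have K0 : 0 < K by exact: powR_gt0.
have KE : (K `^ (- gamma)) ^+ 2 = e / 2.
  rewrite -powR_mulrn ?powR_ge0 // /K -!powRrM -[RHS]powRr1 ?ltW //; congr (_ `^ _).
  by field; rewrite gt_eqF.
pose C1 := 128 / disc_mass R / pi * (2 + K) ^+ 2.
have C0 : 0 < C1.
  apply: mulr_gt0; last by apply: exprn_gt0; apply: addr_gt0.
  by apply: divr_gt0 => //; apply: divr_gt0.
have p0 : 0 <= 2 + 2 * gamma by lra.
near=> n.
have l1 : 1 <= ln (n.+1%:R : R) by near: n; exact: ln_nat_large.
(* The exponent adds the [ln ^ 2] of the Hilbert--Schmidt part and the [2 * gamma] of the target,
   moved across the inequality. *)
have big : C1 * ln (n.+1%:R : R) `^ (2 + 2 * gamma) <= e / 2 * Num.sqrt n.+1%:R.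
  by near: n; exact: ln_power_small.
set l := ln _ in l1 big *; have l0 : 0 < l by exact: lt_le_trans l1.
(* Here [T = K * ln (n + 1)], a ring of width [(n + 1) ^ -K]. *)
apply: le_trans (toeplitz_product_sing_val n hj hk jk (mulr_gt0 K0 l0) hA) _.
rewrite lee_fin [e in leRHS](_ : e = e / 2 + e / 2); last by field.
rewrite [leRHS]mulrDl lerD //.
  rewrite powRM ?(ltW K0) ?(ltW l0) // exprMn KE ler_wpM2l ?(ltW e20) //.
  by rewrite -powR_mulrn ?powR_ge0 // -powRrM mulNr mulrC.
have s0 : 0 < Num.sqrt (n.+1%:R : R) by rewrite sqrtr_gt0 ltr0n.
rewrite ler_pdivrMr //.
have l2g : 0 < l `^ (2 * gamma) by exact: powR_gt0.
have -> : e / 2 * l `^ (- (2 * gamma)) * Num.sqrt n.+1%:R =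
    e / 2 * Num.sqrt n.+1%:R / l `^ (2 * gamma) by rewrite powRN mulrAC.
rewrite ler_pdivlMr //; apply: le_trans big.
have -> : l `^ (2 + 2 * gamma) = l ^+ 2 * l `^ (2 * gamma).
  rewrite powRD; first by rewrite powR_mulrn // ltW.
  by rewrite (gt_eqF l0) implybT.
rewrite [leRHS]mulrA ler_pM2r // /C1 -[leRHS]mulrA ler_wpM2l //.
  by apply: divr_ge0; [apply: divr_ge0 => //|]; exact: ltW.
have Kl : 2 + K * l <= (2 + K) * l by nra.
have Kl0 : 0 <= 2 + K * l by rewrite addr_ge0 // mulr_ge0 // ltW.
by rewrite -exprMn lerXn2r // nnegrE // (le_trans Kl0).
Unshelve. all: by end_near.
Qed.

End ToeplitzProduct.

Theorem theorem3p1 (R : realType) (gamma : R) (L : nat) (j k : nat) :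
  0 < gamma -> (1 <= L)%N ->
  (1 <= j <= L)%N -> (1 <= k <= L)%N -> j != k ->
  Sigma0 (2 * gamma)
    (comp_op (adjoint (toeplitz (chi gamma L k))) (toeplitz (chi gamma L j))) /\
  Sigma0 (2 * gamma)
    (comp_op (toeplitz (chi gamma L k)) (adjoint (toeplitz (chi gamma L j)))).
Proof.
move=> g0 L0 hj hk jk.
have /andP[j0 jL] := hj; have /andP[k0 kL] := hk.
(* Two distinct indices in [1..L] force [L >= 2], so that a sector opens by at most [pi]. *)
have L2' : (2 <= L)%N by move: jk; rewrite neq_ltn => /orP[?|?]; lia.
have mj := cmeas_chi gamma L2' j0; have mk := cmeas_chi gamma L2' k0.
have cj := @csq_chi_le1 R gamma L g0 j; have ck := @csq_chi_le1 R gamma L g0 k.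
(* Since the symbols are real, each product amounts to multiplying by [chi_j], projecting,
   multiplying by [chi_k] and projecting again. *)
split; apply: (toeplitz_product_Sigma0 g0 hj hk jk) => f bf.
  have pj := toeplitz_spec mj cj bf; exists (toeplitz (chi gamma L j) f); split => //.
  by apply: adjoint_spec => //; [exact: cconj_chi|case: pj].
have pj := adjoint_spec mj cj (@cconj_chi R gamma L j) bf.
exists (adjoint (toeplitz (chi gamma L j)) f); split => //.
by apply: toeplitz_spec => //; case: pj.
Qed.
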